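(* Let $M$ be a random measure on a Polish space $\mathbb S$ and let $\mathcal I$ be a countable semi-ring of bounded Borel subsets of $\mathbb S$ which generates the Borel $\sigma$-field $\mathcal S$ and is dissecting, i.e. every open subset of $\mathbb S$ is a countable union of sets in $\mathcal I$ and every bounded Borel set is covered by finitely many sets in $\mathcal I$. Then $M$ is negatively associated (as a random measure) if and only if the random vector $(M(B_1),\dots,M(B_n))$ is negatively associated for all $n\ge1$ and all pairwise disjoint $B_1,\dots,B_n\in\mathcal I$. Likewise, $M$ is positively associated if and only if $(M(B_1),\dots,M(B_n))$ is positively associated for all $n\ge1$ and all pairwise disjoint $B_1,\dots,B_n\in\mathcal I$.
   Context: $\mathbb S$ is a Polish space with Borel $\sigma$-field $\mathcal S$, equipped with a fixed complete metric; ''bounded'' refers to this metric and $\mathcal S_b$ denotes the bounded Borel sets. $\mathbf M(\mathbb S)$ is the space of measures on $\mathbb S$ that are finite on bounded Borel sets, with the $\sigma$-field generated by $\mu\mapsto\mu(B)$, $B\in\mathcal S$, and partial order $\mu<\nu$ iff $\mu(B)\le\nu(B)$ for all $B\in\mathcal S_b$; a function on $\mathbf M(\mathbb S)$ is non-decreasing if it is non-decreasing for $<$. A random measure is a random element of $\mathbf M(\mathbb S)$. For a Borel set $A$, a measurable $f:\mathbf M(\mathbb S)\to\mathbb R$ is measurable with respect to $A$ if it is measurable w.r.t. the $\sigma$-field generated by $\mu\mapsto\mu(B)$, $B\subset A$ Borel (equivalently $f(\mu)=f(\mu(\cdot\cap A))$ for all $\mu$). A random measure $M$ is positively associated (PA)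 if $\mathbb E[f(M)g(M)]\ge\mathbb E[f(M)]\mathbb E[g(M)]$ for all bounded measurable non-decreasing $f,g$ on $\mathbf M(\mathbb S)$; it is negatively associated (NA) if $\mathbb E[f(M)g(M)]\le\mathbb E[f(M)]\mathbb E[g(M)]$ for all bounded measurable non-decreasing $f,g$ that are measurable with respect to disjoint Borel subsets $A,B$ of $\mathbb S$ respectively. A random vector $(Y_1,\dots,Y_n)$ in $\mathbb R^n$ is NA if $\mathbb E[f(Y_J)g(Y_{J^c})]\le\mathbb E[f(Y_J)]\mathbb E[g(Y_{J^c})]$ for all $J\subset\{1,\dots,n\}$ and bounded measurable coordinatewise non-decreasing $f,g$, and PA if $\mathbb E[f(Y_J)g(Y_J)]\ge\mathbb E[f(Y_J)]\mathbb E[g(Y_J)]$ for all $J$ and all such $f,g$ on $\mathbb R^J$. *)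

(* Defs.v *)
From HB Require Import structures.
From mathcomp Require Import all_boot all_order all_algebra.
From mathcomp Require Import all_classical all_reals all_analysis.
From mathcomp Require Import measurable_realfun.
Set Implicit Arguments. Unset Strict Implicit. Unset Printing Implicit Defensive.
Import Order.TTheory GRing.Theory Num.Theory.
Local Open Scope classical_set_scope.
Local Open Scope ring_scope.

(** [S] is a [completePseudoMetricType R]; Polish = complete + Hausdorff
   (so the pseudometric is a metric) + separable. *)
Definition separable_space (R : realType) (S : pseudoPMetricType R) :=
  exists D : set S, countable D /\ dense D.

Definition Borel (R : realType) (S : pseudoPMetricType R) :=
  g_sigma_algebraType (@open S).

Definition metric_bounded (R : realType) (S : pseudoPMetricType R) (B : set S) :=
  exists (x : S) (r : R), B `<=` ball x r.

Definition meas (R : realType) (S : pseudoPMetricType R) :=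
  {measure set (Borel S) -> \bar R}.

Definition locfin (R : realType) (S : pseudoPMetricType R) (mu : meas S) :=
  forall B : set (Borel S), measurable B -> metric_bounded (B : set S) ->
    (mu B < +oo)%E.

Definition meas_le (R : realType) (S : pseudoPMetricType R) (mu nu : meas S) :=
  forall B : set (Borel S), measurable B -> metric_bounded (B : set S) ->
    (mu B <= nu B)%E.

(** The sigma-field on M(S) (relative to the carrier M(S)) generated by the
   evaluation maps mu |-> mu(B), B Borel with B subset A.
   For A = setT this is the sigma-field of M(S). *)
Definition ev_gen (R : realType) (S : pseudoPMetricType R) (A : set S) :
    set (set (meas S)) :=
  fun E => exists (B : set (Borel S)) (U : set (\bar R)),
    [/\ measurable B, (B : set S) `<=` A, measurable U &
        E = [set mu : meas S | locfin mu /\ U (mu B)]].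

Definition ev_sigma (R : realType) (S : pseudoPMetricType R) (A : set S) :
    set (set (meas S)) :=
  <<s [set mu : meas S | locfin mu], ev_gen A >>.

Definition meas_measurable_wrt (R : realType) (S : pseudoPMetricType R)
    (A : set S) (f : meas S -> R) :=
  forall U : set R, measurable U ->
    ev_sigma A ([set mu : meas S | locfin mu] `&` f @^-1` U).

Definition meas_test_fun (R : realType) (S : pseudoPMetricType R)
    (A : set S) (f : meas S -> R) :=
  [/\ exists c : R, forall mu, locfin mu -> `|f mu| <= c,
      meas_measurable_wrt A f &
      forall mu nu, locfin mu -> locfin nu -> meas_le mu nu -> f mu <= f nu].

Definition Exp (R : realType) d (Omega : measurableType d)
    (P : probability Omega R) (X : Omega -> R) : \bar R :=
  (\int[P]_w (X w)%:E)%E.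

(** Random measure: a random element of M(S), i.e. each M w is in M(S) and
   w |-> M w B is measurable for every Borel B (this is measurability w.r.t.
   the sigma-field of M(S) generated by the evaluations). *)
Definition random_measure (R : realType) (S : pseudoPMetricType R) d
    (Omega : measurableType d) (P : probability Omega R) (M : Omega -> meas S) :=
  (forall w, locfin (M w)) /\
  (forall B : set (Borel S), measurable B -> measurable_fun setT (fun w => M w B)).

Definition PA_meas (R : realType) (S : pseudoPMetricType R) d
    (Omega : measurableType d) (P : probability Omega R) (M : Omega -> meas S) :=
  forall f g : meas S -> R, meas_test_fun setT f -> meas_test_fun setT g ->
    (Exp P (fun w => (f (M w) * g (M w))%R) >=
       Exp P (fun w => f (M w)) * Exp P (fun w => g (M w)))%E.

Definition NA_meas (R : realType) (S : pseudoPMetricType R) d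
    (Omega : measurableType d) (P : probability Omega R) (M : Omega -> meas S) :=
  forall (A B : set (Borel S)) (f g : meas S -> R),
    measurable A -> measurable B -> A `&` B = set0 ->
    meas_test_fun (A : set S) f -> meas_test_fun (B : set S) g ->
    (Exp P (fun w => (f (M w) * g (M w))%R) <=
       Exp P (fun w => f (M w)) * Exp P (fun w => g (M w)))%E.

Definition vec_sigma (R : realType) (K : finType) : set (set (K -> R)) :=
  <<s [set E | exists (k : K) (V : set R),
                 measurable V /\ E = (fun x : K -> R => x k) @^-1` V] >>.

Definition vec_test_fun (R : realType) (K : finType) (f : (K -> R) -> R) :=
  [/\ exists c : R, forall x, `|f x| <= c,
      forall U : set R, measurable U -> @vec_sigma R K (f @^-1` U) &
      forall x y : K -> R, (forall k, x k <= y k) -> f x <= f y].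

Definition subvec (R : realType) (I : finType) (J : {set I}) (y : I -> R) :
    {i : I | i \in J} -> R := fun k => y (val k).
Arguments subvec {R I} J y _.

Definition NA_vec (R : realType) d (Omega : measurableType d)
    (P : probability Omega R) (I : finType) (Y : Omega -> I -> R) :=
  forall (J : {set I}) (f : ({i : I | i \in J} -> R) -> R)
         (g : ({i : I | i \in ~: J} -> R) -> R),
    vec_test_fun f -> vec_test_fun g ->
    (Exp P (fun w => (f (subvec J (Y w)) * g (subvec (~: J) (Y w)))%R) <=
       Exp P (fun w => f (subvec J (Y w))) *
       Exp P (fun w => g (subvec (~: J) (Y w))))%E.

Definition PA_vec (R : realType) d (Omega : measurableType d)
    (P : probability Omega R) (I : finType) (Y : Omega -> I -> R) :=
  forall (J : {set I}) (f g : ({i : I | i \in J} -> R) -> R),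
    vec_test_fun f -> vec_test_fun g ->
    (Exp P (fun w => (f (subvec J (Y w)) * g (subvec J (Y w)))%R) >=
       Exp P (fun w => f (subvec J (Y w))) *
       Exp P (fun w => g (subvec J (Y w))))%E.

Definition semiring_of_sets (T : Type) (I : set (set T)) :=
  [/\ I set0, setI_closed I & semi_setD_closed I].

Definition dissecting (R : realType) (S : pseudoPMetricType R) (I : set (set S)) :=
  (forall G : set S, open G ->
     exists C : set (set S), [/\ countable C, C `<=` I & G = \bigcup_(X in C) X]) /\
  (forall B : set (Borel S), measurable B -> metric_bounded (B : set S) ->
     exists C : set (set S),
       [/\ finite_set C, C `<=` I & (B : set S) `<=` \bigcup_(X in C) X]).

Definition count_vec (R : realType) (S : pseudoPMetricType R) d
    (Omega : measurableType d) (M : Omega -> meas S) (n : nat)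
    (B : 'I_n -> set S) : Omega -> 'I_n -> R :=
  fun w i => fine (M w (B i : set (Borel S))).

(* Main.v *)
(** Idea.  Necessity is immediate, a function of the masses of the [B_i] being a
   test function.  For sufficiency, first approximate in [L^1] the indicator of a
   measurable up-set [U] of measures by bounded non-decreasing Lipschitz functions
   of finitely many masses [mu X], [X] in the semi-ring.  By inner regularity [U]
   may be replaced by a subset [F] that is closed for pointwise convergence on the
   semi-ring; then take tent functions [h_n] over the up-closure of [F] in the
   first [n] coordinates.  If [h_n y] does not tend to [0] there are [nu_n] in [F]
   dominated by [y] in the first [n] coordinates up to [1/n]; their limit along an
   ultrafilter is an additive set function dominated by the measure [y], hence
   countably additive, so it extends to a measure of [F] below [y] and [y] is in
   [U].  Bounded monotone functions follow by a
   staircase of up-sets.  For negative association apply this to the restrictions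
   of [M] to the two disjoint Borel sets, which are then replaced by disjoint
   finite unions of semi-ring sets at small [L^1] cost; a common refinement into
   disjoint semi-ring sets reduces to the hypothesis on vectors. *)

Require Import Defs.
From HB Require Import structures.
From mathcomp Require Import all_boot all_order all_algebra.
From mathcomp Require Import all_classical all_reals all_analysis.
From mathcomp Require Import measurable_realfun.
From mathcomp Require Import ring lra.
Set Implicit Arguments. Unset Strict Implicit. Unset Printing Implicit Defensive.
Import Order.TTheory GRing.Theory Num.Theory.
Import numFieldNormedType.Exports.
Local Open Scope classical_set_scope.
Local Open Scope ring_scope.

(** * Semi-rings of sets *)

(** A limit of measures taken set by set on the semi-ring is in general only finitely additive.
    Hence no compact set of measures is sought: [coord_closed] tests closedness only against genuine
    locally finite limits, and compactness is used only below a fixed measure, up to a vanishing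
    error. Regularity is needed because the mass of a Borel set outside the semi-ring is not
    continuous for this convergence; stating it with an exceptional event avoids asking that closed
    sets of measures have measurable preimages. The Lipschitz bound on the approximants serves three
    purposes: measurability, dependence on finitely many masses only, and stability when the two
    Borel sets are replaced by ring sets. The approximants carry no sup bound common to all
    precisions, so in a covariance one factor is approximated first, with its bound, and the
    precision for the other factor is chosen afterwards. *)

Definition disjoint_seq (T : Type) (s : seq (set T)) :=
  forall A B x, A \in s -> B \in s -> A x -> B x -> A = B.

Definition covered (T : Type) (s : seq (set T)) (x : T) :=
  exists2 A, A \in s & A x.

Definition separates (T : Type) (s : seq (set T)) (X : set T) :=
  forall B, B \in s -> B `<=` X \/ B `&` X = set0.

Section semiring_refinement.
Context (T : Type) (I : set (set T)).
Hypothesis Isr : semiring_of_sets I.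

(** Induction on [s]: the head [A] is cut into its trace on [X] and the semi-ring pieces of [A]
    outside [X]. New pieces are disjoint from old ones because each old piece lies in a member of
    [s] other than [A]. *)
Lemma semiring_split (s : seq (set T)) (X : set T) : I X -> uniq s ->
    (forall A, A \in s -> I A) -> disjoint_seq s ->
  exists t, [/\ uniq t, (forall A, A \in t -> I A), disjoint_seq t,
    separates t X &
    (forall B, B \in t -> exists2 A, A \in s & B `<=` A) /\
    (forall x, covered s x -> covered t x)].
Proof.
case: Isr => I0 II ID IX.
elim: s => [_ _ _|A s ih /= /andP[As us] Is ds].
  by exists [::]; split => //; split => // x [].
have [||t [ut It dt st [ts cst]]] := ih us.
- by move=> B Bs; apply: Is; rewrite inE Bs orbT.
- by move=> B C x Bs Cs; apply: ds; rewrite inE ?Bs ?Cs orbT.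
have IA : I A by apply: Is; rewrite inE eqxx.
have [D [/finite_seqP[u uD] DI ADX tD]] := ID A X IA IX.
pose v := (A `&` X) :: u.
have vA B : B \in v -> B `<=` A.
  rewrite inE => /orP[/eqP ->|Bu]; first exact: subIsetl.
  apply: (@subset_trans _ (A `\` X)); last exact: subDsetl.
  by rewrite ADX => x Bx; exists B => //; rewrite uD.
have dAt B C x : B \in v -> C \in t -> B x -> C x -> False.
  move=> Bv Ct Bx Cx.
  have [A' A's CA'] := ts _ Ct.
  have AA' : A = A'.
    by apply: (ds _ _ x); rewrite ?inE ?eqxx ?A's ?orbT//; [exact: (vA B)|exact: CA'].
  by move: As; rewrite AA' A's.
have du B x : B \in u -> B x -> ~ X x.
  move=> Bu Bx; have : (A `\` X) x by rewrite ADX; exists B; rewrite ?uD.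
  by case.
(* [u] may repeat entries and the empty set may occur in both lists, hence [undup]. *)
exists (undup (v ++ t)); split.
- exact: undup_uniq.
- move=> B; rewrite mem_undup mem_cat inE -orbA => /or3P[/eqP -> | Bu | /It //].
    exact: II.
  by apply: DI; rewrite uD.
- move=> B C x; rewrite !mem_undup !mem_cat => /orP[Bv|Bt] /orP[Cv|Ct] Bx Cx.
  + move: Bv Cv; rewrite !inE => /orP[/eqP BA|Bu] /orP[/eqP CA|Cu].
    * by rewrite BA CA.
    * by move: Bx; rewrite BA => -[_ /(du _ _ Cu Cx)].
    * by move: Cx; rewrite CA => -[_ /(du _ _ Bu Bx)].
    * by apply: (tD B C); rewrite ?uD//; exists x.
  + by case: (dAt _ _ x Bv Ct).
  + by case: (dAt _ _ x Cv Bt).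
  + exact: dt Bx Cx.
- move=> B; rewrite mem_undup mem_cat inE -orbA => /or3P[/eqP -> | Bu | /st //].
    by left; exact: subIsetr.
  right; apply/seteqP; split => // x [Bx Xx]; exact: du Bx Xx.
- split.
    move=> B; rewrite mem_undup mem_cat => /orP[Bv|/ts[C Cs BC]].
      by exists A; [rewrite inE eqxx|exact: vA].
    by exists C => //; rewrite inE Cs orbT.
  move=> x [B]; rewrite inE => /orP[/eqP -> Ax|Bs Bx].
    have [Xx|nXx] := pselect (X x).
      by exists (A `&` X) => //; rewrite mem_undup mem_cat inE eqxx.
    have [C Cu Cx] : (\bigcup_(C in D) C) x by rewrite -ADX.
    by exists C => //; rewrite mem_undup mem_cat inE; move: Cu; rewrite uD => ->;
      rewrite orbT.
  have [C Ct Cx] : covered t x by apply: cst; exists B.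
  by exists C => //; rewrite mem_undup mem_cat Ct orbT.
Qed.

Lemma semiring_split_seq (s Xs : seq (set T)) : (forall X, X \in Xs -> I X) ->
    uniq s -> (forall A, A \in s -> I A) -> disjoint_seq s ->
  exists t, [/\ uniq t, (forall A, A \in t -> I A), disjoint_seq t,
    (forall X, X \in Xs -> separates t X) &
    (forall B, B \in t -> exists2 A, A \in s & B `<=` A) /\
    (forall x, covered s x -> covered t x)].
Proof.
elim: Xs => [|X Xs ih] IXs us Is ds.
  by exists s; split => //; split => // B Bs; exists B.
have [|//|//|//|t [ut It dt st [ts cst]]] := ih.
  by move=> Y YXs; apply: IXs; rewrite inE YXs orbT.
have [|//|//|//|u [uu Iu du su [ut' cut]]] := @semiring_split t X.
  by apply: IXs; rewrite inE eqxx.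
exists u; split => //; last first.
  split => [B Bu|x /cst/cut//].
  have [A At BA] := ut' _ Bu; have [A' A's AA'] := ts _ At.
  by exists A' => //; exact: subset_trans AA'.
move=> Y; rewrite inE => /orP[/eqP -> //|YXs] B Bu.
have [A At BA] := ut' _ Bu; have [AY|AY] := st _ YXs _ At.
  by left; exact: subset_trans AY.
by right; apply/seteqP; split => // x [Bx Yx]; rewrite -AY; split => //; exact: BA.
Qed.

(** When [X] joins the family, two refinements are combined: the old pieces [t] are cut along [X],
    and [X] is cut along the old family together with [t], keeping only the pieces that miss [t]. *)
Lemma semiring_refine (Xs : seq (set T)) : (forall X, X \in Xs -> I X) ->
  exists t, [/\ uniq t, (forall A, A \in t -> I A), disjoint_seq t,
    (forall X, X \in Xs -> separates t X) &
    (forall X, X \in Xs -> X `<=` covered t)].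
Proof.
elim: Xs => [_|X Xs ih IXs].
  by exists [::]; split.
have [|t [ut It dt st cst]] := ih.
  by move=> Y YXs; apply: IXs; rewrite inE YXs orbT.
have IX : I X by apply: IXs; rewrite inE eqxx.
have [|//|||u [uu Iu du su [uX cu]]] := @semiring_split_seq [:: X] (Xs ++ t).
- move=> Y; rewrite mem_cat => /orP[YXs|/It //].
  by apply: IXs; rewrite inE YXs orbT.
- by move=> A; rewrite inE => /eqP ->.
- by move=> A B x; rewrite !mem_seq1 => /eqP -> /eqP ->.
have [//|//|//|//|v [uv Iv dv sv [vt cv]]] := @semiring_split t X.
pose u' := [seq B <- u | `[< forall A, A \in t -> B `&` A = set0 >]].
have uXX B : B \in u -> B `<=` X.
  by move=> /uX[A]; rewrite inE => /eqP ->.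
have u'v B C x : B \in u' -> C \in v -> B x -> C x -> False.
  rewrite mem_filter => /andP[/asboolP Bt Bu] Cv Bx Cx.
  have [A At CA] := vt _ Cv.
  by suff : set0 x by []; rewrite -(Bt _ At); split => //; exact: CA.
exists (undup (u' ++ v)); split.
- exact: undup_uniq.
- by move=> A; rewrite mem_undup mem_cat mem_filter => /orP[/andP[_ /Iu]|/Iv].
- move=> B C x; rewrite !mem_undup !mem_cat => /orP[Bv|Bt] /orP[Cv|Ct] Bx Cx.
  + by move: Bv Cv; rewrite !mem_filter => /andP[_ Bu] /andP[_ Cu]; exact: du Bx Cx.
  + by case: (u'v _ _ x Bv Ct).
  + by case: (u'v _ _ x Cv Bt).
  + exact: dv Bx Cx.
- move=> Y YX B; rewrite mem_undup mem_cat mem_filter => /orP[/andP[_ Bu]|Bv].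
    move: YX; rewrite inE => /orP[/eqP ->|YXs]; first by left; exact: uXX.
    by apply: (su Y) => //; rewrite mem_cat YXs.
  move: YX; rewrite inE => /orP[/eqP ->|YXs]; first exact: sv.
  have [A At BA] := vt _ Bv; have [AY|AY] := st _ YXs _ At.
    by left; exact: subset_trans AY.
  right; apply/seteqP; split => // x [Bx Yx]; rewrite -AY; split => //.
  exact: BA.
- move=> Y YX x Yx; have [xt|xt] := pselect (covered t x).
    have [B Bv Bx] := cv _ xt.
    by exists B => //; rewrite mem_undup mem_cat Bv orbT.
  move: YX; rewrite inE => /orP[/eqP YX|YXs]; last first.
    by case: xt; apply: cst Yx.
  have [|B Bu Bx] := cu x; first by exists X; rewrite ?inE// -YX.
  exists B => //; rewrite mem_undup mem_cat mem_filter Bu andbT.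
  apply/orP; left; apply/asboolP => A At.
  have [|BA|//] := su A _ B Bu; first by rewrite mem_cat At orbT.
  by case: xt; exists A => //; exact: BA.
Qed.

(** The ring generated by the semi-ring. The sets in a union may overlap, so unions are immediate
    and differences go through a refinement. *)
Definition in_ring (R : set T) :=
  exists2 s, (forall A, A \in s -> I A) & R = covered s.

Lemma in_ring_sub (A : set T) : I A -> in_ring A.
Proof.
move=> IA; exists [:: A]; first by move=> B; rewrite inE => /eqP ->.
apply/seteqP; split => [x Ax|x [B]]; first by exists A => //; rewrite inE.
by rewrite inE => /eqP ->.
Qed.

Lemma in_ring0 : in_ring set0.
Proof. by apply: in_ring_sub; case: Isr. Qed.

Lemma in_ringU A B : in_ring A -> in_ring B -> in_ring (A `|` B).
Proof.
move=> [s Is ->] [t It ->]; exists (s ++ t).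
  by move=> C; rewrite mem_cat => /orP[/Is|/It].
apply/seteqP; split => [x [[C Cs Cx]|[C Ct Cx]]|x [C]].
- by exists C => //; rewrite mem_cat Cs.
- by exists C => //; rewrite mem_cat Ct orbT.
- by rewrite mem_cat => /orP[Cs|Ct] Cx; [left|right]; exists C.
Qed.

Lemma in_ring_bigcup (F : nat -> set T) n : (forall i, in_ring (F i)) ->
  in_ring (\bigcup_(i < n) F i).
Proof.
move=> rF; rewrite bigcup_mkord; elim/big_ind : _ => [|A B|//].
- exact: in_ring0.
- exact: in_ringU.
Qed.

Lemma ring_refine (Rs : seq (set T)) : (forall R, R \in Rs -> in_ring R) ->
  exists t, [/\ uniq t, (forall A, A \in t -> I A), disjoint_seq t,
    (forall X, X \in Rs -> separates t X) &
    (forall X, X \in Rs -> X `<=` covered t)].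
Proof.
move=> rR.
have {}rR : exists Xs : seq (set T), (forall X, X \in Xs -> I X) /\
    forall R, R \in Rs -> exists2 s, {subset s <= Xs} & R = covered s.
  elim: Rs rR => [_|R Rs ih rR]; first by exists [::].
  have [|Xs [IXs Rh]] := ih.
    by move=> A ARs; apply: rR; rewrite inE ARs orbT.
  have [|s Is Re] := rR R; first by rewrite inE eqxx.
  exists (s ++ Xs); split=> [X|A]; first by rewrite mem_cat => /orP[/Is|/IXs].
  rewrite inE => /orP[/eqP ->|/Rh[t tXs ->]].
    by exists s => // B Bs; rewrite mem_cat Bs.
  by exists t => // B Bs; rewrite mem_cat (tXs _ Bs) orbT.
have [Xs [IXs Rh]] := rR.
have [t [ut It dt st ct]] := semiring_refine IXs.
exists t; split => // R /Rh[s sXs ->].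
- move=> B Bt; have [|h] := pselect (exists2 A, A \in s & B `<=` A).
    by move=> [A As BA]; left => x Bx; exists A => //; exact: BA.
  right; apply/seteqP; split => // x [Bx [A As Ax]].
  have [BA|BA] := st A (sXs _ As) B Bt; first by case: h; exists A.
  by rewrite -BA.
- by move=> x [A As Ax]; apply: (ct A) => //; exact: sXs.
Qed.

Lemma in_ring_refined (t : seq (set T)) (R : set T) :
    (forall A, A \in t -> I A) -> separates t R -> R `<=` covered t ->
  in_ring R.
Proof.
move=> It st ct; exists [seq B <- t | `[< B `<=` R >]].
  by move=> A; rewrite mem_filter => /andP[_ /It].
apply/seteqP; split => [x Rx|x [A]].
  have [B Bt Bx] := ct _ Rx; exists B => //; rewrite mem_filter Bt andbT.
  apply/asboolP; have [//|BR] := st _ Bt.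
  by suff : set0 x by []; rewrite -BR.
by rewrite mem_filter => /andP[/asboolP AR _] /AR.
Qed.

(** In a common refinement of [A] and [B] the difference consists of the pieces inside [A] that miss
    [B]. *)
Lemma in_ringD A B : in_ring A -> in_ring B -> in_ring (A `\` B).
Proof.
move=> rA rB; have [|t [ut It dt st ct]] := @ring_refine [:: A; B].
  by move=> R; rewrite !inE => /orP[] /eqP ->.
have [At Bt] : A \in [:: A; B] /\ B \in [:: A; B] by rewrite !inE !eqxx orbT.
apply: (in_ring_refined It) => [C Ct|x [Ax _]]; last exact: ct Ax.
have [CA|CA] := st A At C Ct; last first.
  by right; rewrite setDE setIA CA set0I.
have [CB|CB] := st B Bt C Ct.
  by right; apply/seteqP; split => // x [/CB ? []].
left => x Cx; split; first exact: CA.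
by move=> Bx; suff : set0 x by []; rewrite -CB.
Qed.

Lemma in_ringI A B : in_ring A -> in_ring B -> in_ring (A `&` B).
Proof. by move=> rA rB; rewrite -setDD; apply: in_ringD => //; exact: in_ringD. Qed.

End semiring_refinement.

(** * Approximation of measurable sets by ring sets *)

Section ring_approximation.
Context d (T : measurableType d) (R : realType) (I : set (set T)).
Hypothesis Isr : semiring_of_sets I.
Hypothesis Igen : <<s I>> = (measurable : set (set T)).

Lemma in_ring_measurable A : in_ring I A -> measurable A.
Proof.
move=> [s Is ->]; rewrite (_ : covered s = \bigcup_(B in [set` s]) B).
  apply: fin_bigcup_measurable => //= B Bs.
  by rewrite -Igen; apply: sub_gen_smallest; exact: Is.
by apply/seteqP; split => x [B Bs Bx]; exists B.
Qed.

(** The approximable sets form a sigma-algebra containing [I]. The size [l] is only monotone,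
    subadditive and continuous at the empty set, so that besides a measure it can be the mean of a
    truncated random mass. *)
Lemma in_ring_approx (e : nat -> set T) (l : set T -> R) (B : set T) :
    (forall i, I (e i)) -> \bigcup_i e i = setT ->
    (forall A C, measurable A -> measurable C -> A `<=` C -> l A <= l C) ->
    (forall A C, measurable A -> measurable C -> l (A `|` C) <= l A + l C) ->
    (forall F : nat -> set T, (forall n, measurable (F n)) ->
      (forall n, F n.+1 `<=` F n) -> \bigcap_n F n = set0 ->
      forall eps, 0 < eps -> exists n, l (F n) < eps) ->
    measurable B ->
  forall eps, 0 < eps ->
    exists2 A, in_ring I A & l ((B `\` A) `|` (A `\` B)) < eps.
Proof.
move=> Ie ecov lmono lU l0; rewrite -Igen.
have mR := in_ring_measurable.
have mD (A C : set T) : measurable A -> measurable C ->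
    measurable ((A `\` C) `|` (C `\` A)).
  by move=> mA mC; apply: measurableU; exact: measurableD.
pose good := [set A : set T | measurable A /\ forall eps, 0 < eps ->
    exists2 C, in_ring I C & l ((A `\` C) `|` (C `\` A)) < eps].
suff sub : <<s I>> `<=` good by move=> /sub[].
have l00 eps : 0 < eps -> l set0 < eps.
  move=> eps0; have [|n //] := l0 (fun=> set0) (fun=> measurable0)
    (fun=> @subset_refl _ _) _ eps eps0.
  by apply/seteqP; split => // x /(_ 0%N); apply.
apply: smallest_sub; last first.
  move=> A IA; split; first by rewrite -Igen; exact: sub_gen_smallest.
  move=> eps /l00 leps; exists A; first exact: in_ring_sub.
  by rewrite setDv setU0.
pose D n := \bigcup_(i < n) e i.
have rD n : in_ring I (D n).
  by apply: in_ring_bigcup => // i; apply: in_ring_sub.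
(* The complement of a ring set need not be in the ring; it is truncated to [D n], outside of which
   [l] is small. *)
have goodC A : good A -> good (setT `\` A).
  move=> [mA gA]; rewrite setTD; split => [|eps eps0]; first exact: measurableC.
  have e20 : 0 < eps / 2 by rewrite divr_gt0.
  have [||| n nD] := l0 (fun n => ~` D n) _ _ _ _ e20.
  - by move=> n; apply: measurableC; exact: mR.
  - by move=> n x + [i /= iN eix]; apply; exists i => //=; exact: ltn_trans iN _.
  - apply/seteqP; split => // x h; have [i _ eix] : (\bigcup_i e i) x by rewrite ecov.
    by apply: (h i.+1 Logic.I); exists i => //=.
  have [C rC lC] := gA _ e20.
  exists (D n `\` C); first exact: in_ringD.
  have mC := mR _ rC; have mDn := mR _ (rD n).
  apply: (@le_lt_trans _ _ (l (((A `\` C) `|` (C `\` A)) `|` ~` D n))).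
    apply: lmono.
    - by apply: (@mD (~` A) (D n `\` C)); [exact: measurableC|exact: measurableD].
    - by apply: measurableU; [exact: mD|exact: measurableC].
    - move=> x /= [[nA nDC]|[[Dx nCx] nnA]].
        have [Dx|] := pselect (D n x); last by right.
        have [Cx|nCx] := pselect (C x); first by left; right.
        by case: nDC.
      by left; left; split => //; exact: contrapT.
  apply: le_lt_trans (lU _ _ _ _) _; [exact: mD|exact: measurableC|].
  by rewrite [eps]splitr ltrD.
have goodU A C : good A -> good C -> good (A `|` C).
  move=> [mA gA] [mC gC]; split => [|eps eps0]; first exact: measurableU.
  have e20 : 0 < eps / 2 by rewrite divr_gt0.
  have [A' rA' lA'] := gA _ e20; have [C' rC' lC'] := gC _ e20.
  have mA' := mR _ rA'; have mC' := mR _ rC'.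
  exists (A' `|` C'); first exact: in_ringU.
  apply: (@le_lt_trans _ _ (l (((A `\` A') `|` (A' `\` A)) `|`
                              ((C `\` C') `|` (C' `\` C))))).
    apply: lmono; first by apply: mD; exact: measurableU.
      by apply: measurableU; exact: mD.
    move=> x /= [[[Ax|Cx] /not_orP[nA' nC']]|[[Ax|Cx] /not_orP[nA' nC']]].
    - by left; left.
    - by right; left.
    - by left; right.
    - by right; right.
  apply: le_lt_trans (lU _ _ _ _) _; [exact: mD|exact: mD|].
  by rewrite [eps]splitr ltrD.
have good0 : good set0.
  split => // eps /l00; exists set0; first exact: in_ring0.
  by rewrite setDv setU0.
split => // F gF; pose G n := \bigcup_(i < n) F i.
have gG n : good (G n).
  by rewrite /G bigcup_mkord; elim/big_ind : _.
have mF : measurable (\bigcup_n F n).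
  by apply: bigcupT_measurable => n; case: (gF n).
split => // eps eps0.
have e20 : 0 < eps / 2 by rewrite divr_gt0.
have [||| n nG] := l0 (fun n => \bigcup_n F n `\` G n) _ _ _ _ e20.
- by move=> n; apply: measurableD => //; case: (gG n).
- move=> n x [Fx nG]; split => // -[i /= iN Fix]; apply: nG; exists i => //=.
  exact: ltn_trans iN _.
- apply/seteqP; split => // x h; have [[i _ Fix] _] := h 0%N Logic.I.
  by have [_] := h i.+1 Logic.I; apply; exists i => /=.
have [mG /(_ _ e20)[C rC lC]] := gG n.
have mC := mR _ rC.
exists C => //.
apply: (@le_lt_trans _ _ (l (((G n `\` C) `|` (C `\` G n)) `|`
                            (\bigcup_n F n `\` G n)))).
  apply: lmono; first exact: mD.
    by apply: measurableU; [exact: mD|exact: measurableD].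
  move=> x /= [[Fx nC]|[Cx nFx]].
    have [Gx|nGx] := pselect (G n x); last by right.
    by left; left.
  left; right; split => // -[i _ Fix]; apply: nFx; by exists i.
apply: le_lt_trans (lU _ _ _ _) _; [exact: mD|exact: measurableD|].
by rewrite [eps]splitr ltrD.
Qed.

End ring_approximation.

(** * Measures on semi-rings *)

Section measure_blocks.
Context d (T : measurableType d) (R : realType).
Implicit Types (nu : {measure set T -> \bar R}) (t : seq (set T)).

Lemma measure_blocks nu t (X : set T) : uniq t ->
    (forall A, A \in t -> measurable A) -> disjoint_seq t ->
    separates t X -> X `<=` covered t ->
  nu X = (\sum_(B <- t | `[< B `<=` X >]) nu B)%E.
Proof.
move=> ut mt dt st ct; pose s := [seq B <- t | `[< B `<=` X >]].
have XE : X = \bigcup_(B in [set` s]) B.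
  apply/seteqP; split => [x Xx|x [B]]; last first.
    by rewrite /= mem_filter => /andP[/asboolP BX _] /BX.
  have [B Bt Bx] := ct _ Xx; exists B => //=; rewrite mem_filter Bt andbT.
  apply/asboolP; have [//|BX] := st _ Bt.
  by suff : set0 x by []; rewrite -BX.
rewrite [in LHS]XE measure_fin_bigcup.
- by rewrite -fsbig_seq ?filter_uniq// big_filter.
- by apply/finite_seqP; exists s.
- move=> A B; rewrite /= !mem_filter => /andP[_ At] /andP[_ Bt] [x [Ax Bx]].
  exact: dt Ax Bx.
- by move=> B; rewrite /= mem_filter => /andP[_ /mt].
Qed.

Lemma fine_measure_blocks nu t (X : set T) : uniq t ->
    (forall A, A \in t -> measurable A) -> disjoint_seq t ->
    separates t X -> X `<=` covered t -> measurable X -> (nu X < +oo)%E ->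
  fine (nu X) = \sum_(B <- t | `[< B `<=` X >]) fine (nu B).
Proof.
move=> ut mt dt st ct mX fX; rewrite (measure_blocks nu ut mt dt st ct).
rewrite big_seq_cond [in RHS]big_seq_cond.
rewrite (eq_bigr (fun B => (fine (nu B))%:E)) ?sumEFin// => B /andP[Bt /asboolP BX].
rewrite fineK// ge0_fin_numE//.
by apply: le_lt_trans fX; apply: le_measure; rewrite ?inE//; exact: mt.
Qed.

End measure_blocks.

(* A copy of [T] with the sets of [I] as measurable sets, to which
   Caratheodory's extension theorem applies. *)
Definition semiring_type (T : pointedType) (I : set (set T))
  (Isr : semiring_of_sets I) : Type := T.

HB.instance Definition _ (T : pointedType) (I : set (set T))
  (Isr : semiring_of_sets I) := Pointed.on (semiring_type Isr).

HB.instance Definition _ (T : pointedType) (I : set (set T))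
    (Isr : semiring_of_sets I) :=
  @isSemiRingOfSets.Build (sigma_display I) (semiring_type Isr) I
    (let: And3 h _ _ := Isr in h) (let: And3 _ h _ := Isr in h)
    (let: And3 _ _ h := Isr in h).

(** The extension lives on the copy of [T]; its measurable sets are those of [T] because [I]
    generates them, so the same function can be packed again as a measure on [T]. *)
Lemma semiring_measure_extension d (T : measurableType d) (R : realType)
    (I : set (set T)) (k : set T -> \bar R) :
    semiring_of_sets I -> <<s I>> = (measurable : set (set T)) ->
    k set0 = 0%E -> (forall A, (0 <= k A)%E) ->
    (forall F : nat -> set T, (forall i, I (F i)) -> trivIset setT F ->
      I (\bigcup_i F i) ->
      (fun n => (\sum_(0 <= i < n) k (F i))%E) @ \oo --> k (\bigcup_i F i)) ->
  exists nu : {measure set T -> \bar R}, forall A, I A -> nu A = k A.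
Proof.
move=> Isr Igen k0 kge0 ksig.
pose k' : set (semiring_type Isr) -> \bar R := k.
pose km := isMeasure.Build _ (semiring_type Isr) R k' k0 kge0 ksig.
pose kmu : {measure set (semiring_type Isr) -> \bar R} := HB.pack k' km.
pose ext : {measure set _ -> \bar R} := measure_extension kmu.
pose nu : set T -> \bar R := ext.
have nu0 : nu set0 = 0%E by exact: measure0.
have nuge0 A : (0 <= nu A)%E by exact: measure_ge0.
have nusig : semi_sigma_additive nu.
  move=> F mF tF mUF; apply: (@measure_semi_sigma_additive _ _ _ ext) => //.
    by move=> i; rewrite /measurable /= Igen.
  by rewrite /measurable /= Igen.
pose num := isMeasure.Build _ T R nu nu0 nuge0 nusig.
exists (HB.pack nu num : {measure set T -> \bar R}) => A IA.
exact: (@measurable_mu_extE _ _ _ kmu).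
Qed.

(** By compactness of the segment the image of the ultrafilter has a cluster point, and an
    ultrafilter converges to its cluster points. *)
Lemma bounded_ultra_cvg (R : realType) (F : set_system nat) (u : nat -> R)
    (c : R) : UltraFilter F -> F [set n | 0 <= u n <= c] -> cvg (u @ F).
Proof.
move=> FU Fu.
have FF : ProperFilter F by exact: ultra_proper.
have uF : (u @ F) [set` `[0, c]].
  by rewrite nbhs_filterE; apply: (@filterS _ F _ [set n | 0 <= u n <= c]) => // n h;
    rewrite /= in_itv.
have [p [_ cp]] : [set` `[0, c]] `&` cluster (u @ F) !=set0.
  by apply: (@segment_compact R 0 c).
apply/cvg_ex; exists p => V Vp.
have [//|FC] := in_ultra_setVsetC (u @^-1` V) FU.
suff : (u @ F) (~` V) by move=> /cp/(_ Vp)[x []].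
exact: FC.
Qed.

(** * Limits of dominated measures *)

(** The hypotheses on the semi-ring in the form used below: [e] lists [I], possibly with
    repetitions, and a bounded Borel set is covered by a single ring set. *)
Record dissecting_system (R : realType) (S : pseudoPMetricType R)
    (I : set (set S)) (e : nat -> set S) : Prop := DissectingSystem {
  ds_semiring : semiring_of_sets I ;
  ds_measurable : forall X, I X -> measurable (X : set (Borel S)) ;
  ds_bounded : forall X, I X -> metric_bounded X ;
  ds_gen : <<s I>> = (measurable : set (set (Borel S))) ;
  ds_cover : forall B : set (Borel S), measurable B ->
    metric_bounded (B : set S) -> exists2 D, in_ring I D & B `<=` D ;
  ds_mem : forall n, I (e n) ;
  ds_enum : forall X, I X -> exists n, X = e n ;
  ds_total : \bigcup_n e n = setT }.

Section dominated_limits.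
Context (R : realType) (S : pseudoPMetricType R).
Context (I : set (set S)) (e : nat -> set S).
Hypothesis ds : dissecting_system I e.

Let Isr := ds_semiring ds.
Let Igen := ds_gen ds.

Lemma ds_ring_measurable (D : set S) :
  in_ring I D -> measurable (D : set (Borel S)).
Proof. exact: (@in_ring_measurable _ (Borel S)). Qed.

Lemma locfin_lty (mu : meas S) (X : set S) : locfin mu -> I X -> (mu X < +oo)%E.
Proof.
by move=> fmu IX; apply: fmu; [exact: (ds_measurable ds)|exact: (ds_bounded ds)].
Qed.

(** Finiteness is assumed on [I] only, so that the lemma applies to an extended measure not yet
    known to be locally finite. *)
Lemma ring_lty (mu : meas S) (D : set S) :
  (forall X, I X -> (mu X < +oo)%E) -> in_ring I D -> (mu D < +oo)%E.
Proof.
move=> fmu rD; have [|t [ut It dt st ct]] := @ring_refine _ _ Isr [:: D].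
  by move=> A; rewrite mem_seq1 => /eqP ->.
rewrite (measure_blocks mu ut (fun A At => ds_measurable ds (It A At)) dt) //.
- rewrite big_seq_cond; apply: lte_sum_pinfty => B /andP[/It IB _].
  exact: fmu.
- by apply: st; rewrite mem_seq1.
- by apply: ct; rewrite mem_seq1.
Qed.

(** The error is measured inside [D], where [mu] is finite: this gives the continuity at the empty
    set that [in_ring_approx] asks for. *)
Lemma measure_ring_approx (mu : meas S) (D : set S) (B : set (Borel S)) :
    measurable (D : set (Borel S)) -> (mu D < +oo)%E -> measurable B ->
  forall eps : R, 0 < eps -> exists2 A, in_ring I A &
    (mu (((B `\` A) `|` (A `\` B)) `&` D) < eps%:E)%E.
Proof.
move=> mD fD mB eps eps0.
have fin (A : set (Borel S)) : measurable A -> mu (A `&` D) \is a fin_num.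
  move=> mA; rewrite ge0_fin_numE//; apply: le_lt_trans fD.
  by apply: le_measure; rewrite ?inE//; exact: measurableI.
have [|||A rA lA] := @in_ring_approx _ (Borel S) R I Isr Igen e
    (fun A => fine (mu (A `&` D))) B (ds_mem ds) (ds_total ds) _ _ _ mB _ eps0.
- move=> A C mA mC AC; rewrite fine_le ?fin//.
  by apply: le_measure; rewrite ?inE; [exact: measurableI..|exact: setSI].
- move=> A C mA mC; rewrite -fineD ?fin// fine_le ?fin//.
  + exact: measurableU.
  + by rewrite fin_numD !fin.
  + by rewrite setIUl; apply: measureU2; exact: measurableI.
- move=> F mF dF F0 eps' eps'0.
  have : (fun n => mu (F n `&` D)) @ \oo --> 0%:E.
    have -> : 0%:E = mu (\bigcap_n (F n `&` D)).
      rewrite (_ : \bigcap_n _ = set0) ?measure0//; apply/seteqP; split => // x h.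
      by rewrite -F0 => n _; have [] := h n Logic.I.
    apply: nonincreasing_cvg_mu.
    + by rewrite -ge0_fin_numE ?fin.
    + by move=> n; exact: measurableI.
    + by apply: bigcapT_measurable => n; exact: measurableI.
    + apply/nonincreasing_seqP => n; apply/subsetPset; exact: setSI.
  move=> /fine_cvg/cvgrPdist_lt/(_ _ eps'0)[n _ /(_ n (leqnn n))] /=.
  rewrite sub0r normrN ger0_norm ?fine_ge0// => h.
  by exists n.
exists A => //; move: lA; rewrite -lte_fin fineK// fin//.
have mA := ds_ring_measurable rA.
by apply: measurableU; exact: measurableD.
Qed.

Lemma ring_le (mu nu : meas S) (D : set S) :
  (forall X, I X -> (mu X <= nu X)%E) -> in_ring I D -> (mu D <= nu D)%E.
Proof.
move=> le rD; have [|t [ut It dt st ct]] := @ring_refine _ _ Isr [:: D].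
  by move=> A; rewrite mem_seq1 => /eqP ->.
have mt A (At : A \in t) := ds_measurable ds (It A At).
have {}st := st D (mem_head _ _); have {}ct := ct D (mem_head _ _).
rewrite (measure_blocks mu ut mt dt st ct) (measure_blocks nu ut mt dt st ct).
by rewrite big_seq_cond [leRHS]big_seq_cond; apply: lee_sum => B /andP[/It/le].
Qed.

Lemma meas_le_semiring (mu nu : meas S) : locfin mu -> locfin nu ->
  (forall X, I X -> (mu X <= nu X)%E) -> meas_le mu nu.
Proof.
move=> fmu fnu le B mB /[dup] bB /(ds_cover ds mB)[D rD BD].
have mD := ds_ring_measurable rD.
apply/lee_addgt0Pr => eps eps0.
have e20 : 0 < eps / 2 by rewrite divr_gt0.
(* Approximating for the sum of the two measures yields one ring set that is good for both. *)
pose lam : meas S := measure_add mu nu.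
have lamE (A : set S) : lam A = (mu A + nu A)%E by exact: measure_addE.
have [|A rA lA] := @measure_ring_approx lam D B mD _ mB _ e20.
  rewrite lamE lte_add_pinfty// ring_lty// => X.
    exact: locfin_lty.
  exact: locfin_lty.
have mA := ds_ring_measurable rA.
set Z := _ `&` D in lA.
have mZ : measurable (Z : set (Borel S)).
  by apply: measurableI => //; apply: measurableU; exact: measurableD.
have [muZ nuZ] : (mu Z <= (eps / 2)%:E)%E /\ (nu Z <= (eps / 2)%:E)%E.
  split; apply: le_trans (ltW lA); rewrite lamE.
    by rewrite leeDl.
  by rewrite leeDr.
have BAZ : (mu B <= mu (A `&` D) + mu Z)%E.
  apply: le_trans (measureU2 _ _ _) => //; last exact: measurableI.
  apply: le_measure; rewrite ?inE//.
    by apply: measurableU => //; exact: measurableI.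
  move=> x Bx; have Dx := BD x Bx; have [Ax|nAx] := pselect (A x).
    by left.
  by right; split => //; left.
have ABZ : (nu (A `&` D) <= nu B + nu Z)%E.
  apply: le_trans (measureU2 _ _ _) => //.
  apply: le_measure; rewrite ?inE//; first exact: measurableI.
    exact: measurableU.
  move=> x [Ax Dx]; have [Bx|nBx] := pselect (B x); first by left.
  by right; split => //; right.
apply: (le_trans BAZ); rewrite [eps]splitr EFinD addeA leeD//.
apply: le_trans (_ : nu (A `&` D) <= _)%E.
  by apply: ring_le => //; exact: in_ringI.
by apply: (le_trans ABZ); rewrite leeD.
Qed.

(* The difference of the two sides of additivity is a finite sum of masses of
   semi-ring sets, with a decomposition that does not depend on the measure. *)
Lemma semiring_remainder (F : nat -> set S) (n : nat) : (forall i, I (F i)) ->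
    trivIset setT F -> I (\bigcup_i F i) ->
  exists2 t : seq (set S), (forall B, B \in t -> I B) &
    forall mu : meas S, locfin mu ->
      fine (mu (\bigcup_i F i)) - \sum_(0 <= i < n) fine (mu (F i)) =
      \sum_(B <- t) fine (mu B).
Proof.
move=> IF tF IUF; pose G := \bigcup_i F i; pose H := \bigcup_(i < n) F i.
have rH : in_ring I H by apply: in_ring_bigcup => // i; exact: in_ring_sub.
have rG : in_ring I G by exact: in_ring_sub.
have HG : H `<=` G by move=> x [i _ Fix]; exists i.
have [|t [ut It dt st ct]] := @ring_refine _ _ Isr [:: G `\` H].
  by move=> A; rewrite mem_seq1 => /eqP ->; exact: in_ringD.
have mt A (At : A \in t) := ds_measurable ds (It A At).
have {}st := st _ (mem_head _ _); have {}ct := ct _ (mem_head _ _).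
exists [seq B <- t | `[< B `<=` G `\` H >]] => [B|mu fmu].
  by rewrite mem_filter => /andP[_ /It].
have fG : (mu G < +oo)%E by exact: locfin_lty.
have mG : measurable (G : set (Borel S)) by exact: (ds_measurable ds).
have mH := ds_ring_measurable rH.
rewrite big_filter.
rewrite -(@fine_measure_blocks _ (Borel S) R mu t _ ut mt dt st ct); last 2 first.
- exact: measurableD.
- apply: le_lt_trans fG; apply: le_measure; rewrite ?inE//; exact: measurableD.
have fH : mu H \is a fin_num.
  by rewrite ge0_fin_numE//; apply: ring_lty => // X; exact: locfin_lty.
rewrite measureD// (setIidr HG) fineB//; last by rewrite ge0_fin_numE.
congr (_ - _); rewrite /H bigcup_mkord measure_bigsetU//; last first.
  by move=> i; exact: (ds_measurable ds).
rewrite big_mkord -[LHS]/(fine _%:E) -sumEFin; congr fine.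
apply: eq_bigr => i _; rewrite fineK// ge0_fin_numE//.
exact: locfin_lty.
Qed.

(* Domination by the measure [y] makes the limit countably additive. *)
Lemma dominated_limit (nu_ : nat -> meas S) (y : meas S) :
    (forall n, locfin (nu_ n)) -> locfin y ->
    (forall n i, (i < n)%N ->
      fine (nu_ n (e i)) <= fine (y (e i)) + n.+1%:R^-1) ->
  exists nu : meas S, [/\ locfin nu, meas_le nu y &
    forall n eps, 0 < eps -> exists m, forall i, (i < n)%N ->
      `|fine (nu_ m (e i)) - fine (nu (e i))| < eps].
Proof.
move=> fnu fy nuy.
(* An ultrafilter gives the limits on all semi-ring sets at once, without extracting
   subsequences. *)
have [U [UU oU]] := ultraFilterLemma (@eventually_filter).
have UF : ProperFilter U by exact: ultra_proper.
pose r X := lim ((fun n => fine (nu_ n X)) @ U).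
have nuyX X eps : 0 < eps -> I X ->
    U [set n | fine (nu_ n X) <= fine (y X) + eps].
  move=> eps0 /(ds_enum ds)[i ->].
  have hN : \forall n \near \oo, n.+1%:R^-1 <= eps.
    near=> n; apply/ltW; near: n; exact: near_infty_natSinv_lt (PosNum eps0).
  have hi : \forall n \near \oo, (i < n)%N by exact: nbhs_infty_gt.
  apply: oU; apply: filterS2 hN hi => n /= hn /nuy h.
  by apply: le_trans h _; rewrite lerD2l.
have cr X : I X -> (fun n => fine (nu_ n X)) @ U --> r X.
  move=> IX; apply: (@bounded_ultra_cvg _ _ _ (fine (y X) + 1)) => //.
  by apply: filterS (nuyX X 1 ltr01 IX) => n /= ->; rewrite fine_ge0.
have r0 X : I X -> 0 <= r X.
  move=> IX; apply: limr_ge; first by apply/cvg_ex; exists (r X); exact: cr.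
  by apply: filterE => n; rewrite fine_ge0.
have ry X : I X -> r X <= fine (y X).
  move=> IX; apply/ler_addgt0Pr => eps eps0; apply: limr_le.
    by apply/cvg_ex; exists (r X); exact: cr.
  exact: nuyX.
(* Off [I] the default value 0 keeps the set function nonnegative everywhere. *)
pose k X := if pselect (I X) then (r X)%:E else 0%E.
have kE X : I X -> k X = (r X)%:E by rewrite /k; case: pselect.
have k0 : k set0 = 0%E.
  have I0 : I set0 by case: Isr.
  rewrite kE//; congr EFin; apply/eqP; rewrite eq_le r0// andbT.
  by apply: le_trans (ry _ I0) _; rewrite measure0.
have kge0 X : (0 <= k X)%E.
  by rewrite /k; case: pselect => // IX; rewrite lee_fin r0.
have csum (t : seq (set S)) : (forall B, B \in t -> I B) ->
    (fun n => \sum_(B <- t) fine (nu_ n B)) @ U --> \sum_(B <- t) r B.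
  move=> It; rewrite big_seq; under eq_fun do rewrite big_seq.
  by apply: cvg_big => [|B /It]; [exact: add_continuous|exact: cr].
have ksig (F : nat -> set S) : (forall i, I (F i)) -> trivIset setT F ->
    I (\bigcup_i F i) ->
    (fun n => (\sum_(0 <= i < n) k (F i))%E) @ \oo --> k (\bigcup_i F i).
  move=> IF tF IUF; rewrite kE//.
  under eq_fun do (under eq_bigr do rewrite kE//; rewrite sumEFin).
  apply: cvg_EFin; first exact: nearW.
  have yc : (fun n => \sum_(0 <= i < n) fine (y (F i))) @ \oo -->
      fine (y (\bigcup_i F i)).
    have : (fun n => (\sum_(0 <= i < n) y (F i))%E) @ \oo -->
        (fine (y (\bigcup_i F i)))%:E.
      rewrite fineK ?ge0_fin_numE ?locfin_lty//.
      apply: measure_semi_sigma_additive => // [i|]; exact: (ds_measurable ds).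
    move=> /fine_cvg; apply: cvg_trans; apply: near_eq_cvg; apply: nearW => n /=.
    rewrite -[RHS]/(fine _%:E) -sumEFin; congr fine; apply: eq_bigr => i _.
    by rewrite fineK// ge0_fin_numE// locfin_lty.
  apply/cvgrPdist_le => eps eps0.
  move/cvgrPdist_le : yc => /(_ _ eps0); apply: filterS => n.
  (* What is missing after [n] terms is a sum over [t] of semi-ring masses, for every measure alike.
     Hence the remainder for [r] is at most that for [y], which tends to 0 since [y] is countably
     additive. *)
  have [t It tE] := semiring_remainder n IF tF IUF.
  rewrite tE//.
  have -> : r (\bigcup_i F i) - \sum_(0 <= i < n) r (F i) = \sum_(B <- t) r B.
    apply: cvg_unique (csum t It); first exact: norm_hausdorff.
    rewrite -(_ : (fun m => fine (nu_ m (\bigcup_i F i)) -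
        \sum_(0 <= i < n) fine (nu_ m (F i))) = fun m => \sum_(B <- t) fine (nu_ m B));
      last by apply/funext => m; rewrite tE.
    apply: cvgB; first exact: cr.
    by apply: cvg_big => [|i _]; [exact: add_continuous|exact: cr].
  apply: le_trans; rewrite !ger0_norm//.
  - by rewrite big_seq [leRHS]big_seq; apply: ler_sum => B /It; exact: ry.
  - by apply: sumr_ge0 => B _; rewrite fine_ge0.
  - by rewrite big_seq; apply: sumr_ge0 => B /It; exact: r0.
have [nu nuE] := @semiring_measure_extension _ (Borel S) R I k Isr Igen k0 kge0 ksig.
have nufin X : I X -> (nu X < +oo)%E by move=> IX; rewrite nuE// kE// ltry.
have fnu' : locfin nu.
  move=> B mB /(ds_cover ds mB)[D rD BD].
  apply: le_lt_trans (ring_lty nufin rD).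
  by apply: le_measure; rewrite ?inE//; exact: ds_ring_measurable.
exists nu; split => //.
  apply: meas_le_semiring => // X IX; rewrite nuE// kE//.
  by rewrite -[leRHS]fineK ?lee_fin ?ry// ge0_fin_numE// locfin_lty.
move=> n eps eps0.
(* Members of the ultrafilter are nonempty, so one index serves finitely many coordinates. *)
have : U [set m | forall i, (i < n)%N ->
    `|fine (nu_ m (e i)) - fine (nu (e i))| < eps].
  elim: n => [|n ih]; first exact: filterE.
  have := cr (e n) (ds_mem ds n); move=> /cvgrPdist_lt/(_ _ eps0).
  apply: filterS2 ih => m ih hm i; rewrite ltnS leq_eqVlt => /orP[/eqP ->|/ih//].
  by rewrite nuE ?kE 1?distrC//; exact: (ds_mem ds).
by move=> /filter_ex.
Unshelve. all: by end_near. Qed.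

End dominated_limits.

(** * Inner regularity of the law of a random measure *)

HB.instance Definition _ (R : realType) (S : pseudoPMetricType R) :=
  gen_eqMixin (meas S).
HB.instance Definition _ (R : realType) (S : pseudoPMetricType R) :=
  gen_choiceMixin (meas S).
HB.instance Definition _ (R : realType) (S : pseudoPMetricType R) :=
  isPointed.Build (meas S) mzero.

Section regularity.
Context (R : realType) (S : pseudoPMetricType R).
Context (I : set (set S)) (e : nat -> set S).
Hypothesis ds : dissecting_system I e.
Context d (Omega : measurableType d) (P : probability Omega R).
Variable N : Omega -> meas S.
Hypothesis rN : random_measure P N.

Let Isr := ds_semiring ds.
Let Igen := ds_gen ds.
Let fN w : locfin (N w). Proof. by case: rN. Qed.
Let mN (B : set (Borel S)) : measurable B ->
  measurable_fun setT (fun w => N w B).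
Proof. by case: rN => _; apply. Qed.

Definition coord (mu : meas S) (X : set S) : R := fine (mu X).

(* Closedness among locally finite measures for the topology of pointwise
   convergence on the semi-ring. *)
Definition coord_closed (F : set (meas S)) :=
  F `<=` locfin (S := S) /\
  forall nu, locfin nu -> (forall n eps, 0 < eps ->
    exists2 nu', F nu' & forall i, (i < n)%N ->
      `|coord nu' (e i) - coord nu (e i)| < eps) -> F nu.

(** Approximating from inside and outside at once makes the notion stable under complement. The
    event [Z] stands for [N] falling between [F] and the complement of [C], whose preimages need not
    be measurable. *)
Definition inner_outer_regular (G : set (meas S)) :=
  measurable (N @^-1` G) /\ forall eps, 0 < eps ->
  exists F C Z, [/\ coord_closed F, coord_closed C, F `<=` G, C `<=` ~` G &
    [/\ measurable Z, (P Z < eps%:E)%E & forall w, ~ Z w -> F (N w) \/ C (N w)]].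

Lemma coord_closed0 : coord_closed set0.
Proof. by split => // nu _ /(_ 0%N 1 ltr01)[]. Qed.

Lemma coord_closedT : coord_closed (@locfin R S).
Proof. by split. Qed.

(** If [nu] is away from [F] on finitely many coordinates, every finer approximation of [nu] comes
    from [G]. *)
Lemma coord_closedU F G :
  coord_closed F -> coord_closed G -> coord_closed (F `|` G).
Proof.
move=> [Ff cF] [Gf cG]; split => [nu [/Ff|/Gf]//|nu fnu h].
have [|] := pselect (forall n eps, 0 < eps -> exists2 nu', F nu' &
  forall i, (i < n)%N -> `|coord nu' (e i) - coord nu (e i)| < eps).
  by move=> /cF cFnu; left; exact: cFnu.
move=> /existsNP[n1] /existsNP[e1] /not_implyP[e10 nF]; right.
apply: cG => // n2 e2 e20.
have [|nu' [Fnu'|Gnu'] hnu'] := h (maxn n1 n2) (Num.min e1 e2).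
- by rewrite lt_min e10.
- case: nF; exists nu' => // i iN; apply: (lt_le_trans (hnu' i _)).
    by rewrite leq_max iN.
  by rewrite ge_min lexx.
- exists nu' => // i iN; apply: (lt_le_trans (hnu' i _)).
    by rewrite leq_max iN orbT.
  by rewrite ge_min lexx orbT.
Qed.

Lemma coord_closed_bigcap (F : nat -> set (meas S)) :
  (forall n, coord_closed (F n)) -> coord_closed (\bigcap_n F n).
Proof.
move=> cF; split => [nu /(_ 0%N Logic.I)|nu fnu h n _]; first exact: (cF 0%N).1.
apply: (cF n).2 => // m eps /(h m)[nu' Fnu' hnu'].
by exists nu' => //; exact: Fnu'.
Qed.

Lemma inner_outer_regularC G :
  inner_outer_regular G -> inner_outer_regular (~` G).
Proof.
move=> [mG rG]; split; first by rewrite preimage_setC; exact: measurableC.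
move=> eps /rG[F [C [Z [cF cC FG CG [mZ PZ FC]]]]].
exists C, F, Z; split => //; first by rewrite setCK.
by split => // w /FC[]; [right|left].
Qed.

(** Closed sets are stable under all countable intersections but only finite unions: the outer sets
    [C n] are all intersected, the inner sets stop at [m], and [V m] is the event lost by
    stopping. *)
Lemma inner_outer_regular_bigcup (G : nat -> set (meas S)) :
  (forall n, inner_outer_regular (G n)) -> inner_outer_regular (\bigcup_n G n).
Proof.
move=> rG; have mG n : measurable (N @^-1` G n) by case: (rG n).
split; first by rewrite preimage_bigcup; exact: bigcupT_measurable.
move=> eps eps0; have e20 : 0 < eps / 2 by rewrite divr_gt0.
(* Geometric weights: the exceptional events together cost at most [eps / 2]. *)
have en0 n : 0 < (eps / 2) / (2 ^ n.+1)%:R.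
  by rewrite divr_gt0// ltr0n expn_gt0.
have /choice[F /choice[C /choice[Z FCZ]]] : forall n, exists F C Z,
    [/\ coord_closed F, coord_closed C, F `<=` G n, C `<=` ~` G n &
    [/\ measurable Z, (P Z < ((eps / 2) / (2 ^ n.+1)%:R)%:E)%E &
      forall w, ~ Z w -> F (N w) \/ C (N w)]].
  by move=> n; exact: (rG n).2.
pose V n := N @^-1` (\bigcup_i G i) `\` N @^-1` (\bigcup_(i < n) G i).
have mV n : measurable (V n).
  rewrite /V !preimage_bigcup; apply: measurableD; apply: bigcup_measurable => //.
have V0 : (fun n => P (V n)) @ \oo --> 0%E.
  rewrite -(measure0 P) (_ : set0 = \bigcap_n V n).
    apply: nonincreasing_cvg_mu => //.
    + by rewrite ltey_eq fin_num_measure.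
    + exact: bigcapT_measurable.
    + apply/nonincreasing_seqP => n; apply/subsetPset => w [Gw nGw]; split => //.
      by move=> [i /= iN Giw]; apply: nGw; exists i => //=; exact: ltn_trans iN _.
  apply/seteqP; split => // w h; have [[i _ Giw] _] := h 0%N Logic.I.
  by have [_] := h i.+1 Logic.I; apply; exists i => /=.
have [m PVm] : exists m, (P (V m) < (eps / 2)%:E)%E.
  have /fine_cvg/cvgrPdist_lt/(_ _ e20)[m _ /(_ m (leqnn m))] := V0.
  rewrite /= sub0r normrN ger0_norm ?fine_ge0// => h; exists m.
  by rewrite -[P _]fineK ?fin_num_measure.
have mZ n : measurable (Z n) by case: (FCZ n) => _ _ _ _ [].
have mUZ : measurable (\bigcup_n Z n) by exact: bigcupT_measurable.
exists (\bigcup_(i < m) F i), (\bigcap_n C n), (\bigcup_n Z n `|` V m); split.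
- rewrite bigcup_mkord; elim/big_ind : _ => [|A B|i _].
  + exact: coord_closed0.
  + exact: coord_closedU.
  + by case: (FCZ i).
- by apply: coord_closed_bigcap => n; case: (FCZ n).
- by move=> nu [i _ Fi]; exists i => //; have [_ _ FG _ _] := FCZ i; exact: FG.
- move=> nu Cnu [i _ Gi]; have [_ _ _ CG _] := FCZ i.
  exact: (CG nu (Cnu i Logic.I) Gi).
split; first exact: measurableU.
- apply: le_lt_trans (measureU2 _ _ _) _ => //.
  rewrite [eps]splitr EFinD; apply: lee_ltD => //; first exact: fin_num_measure.
  apply: le_trans (measure_sigma_subadditive P mZ mUZ (@subset_refl _ _)) _.
  apply: (@le_trans _ _
    (\sum_(0 <= i <oo) (0 + ((eps / 2) / (2 ^ i.+1)%:R)%:E))%E).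
    apply: lee_nneseries => // n _; rewrite add0e; apply/ltW.
    by case: (FCZ n) => _ _ _ _ [].
  apply: le_trans (epsilon_trick _ _ _) _ => //; first exact: ltW.
  by rewrite eseries0 ?add0e// => i.
- move=> w /not_orP[nZ nV].
  have FCw n : F n (N w) \/ C n (N w).
    have [_ _ _ _ [_ _ FC]] := FCZ n.
    by apply: FC => Znw; apply: nZ; exists n.
  have [[i _ Giw]|nGw] := pselect ((\bigcup_n G n) (N w)).
    left; have [j /= jm Gj] : (\bigcup_(i < m) G i) (N w).
      by apply: contrapT => nGw; apply: nV; split => //; exists i.
    exists j => //; have [//|Cj] := FCw j.
    by have [_ _ _ CG _] := FCZ j; case: (CG _ Cj).
  right => n _; have [Fn|//] := FCw n.
  by have [_ _ FG _ _] := FCZ n; case: nGw; exists n => //; exact: FG.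
Qed.

Lemma inner_outer_regular_sigma : sigma_algebra setT inner_outer_regular.
Proof.
split.
- split; first by rewrite preimage_set0.
  move=> eps eps0; exists set0, (@locfin R S), set0; split => //.
  + exact: coord_closed0.
  + exact: coord_closedT.
  + by move=> mu _ [].
  + by split => // [|w _]; [rewrite measure0 lte_fin|right; exact: fN].
- by move=> A rA; rewrite setTD; exact: inner_outer_regularC.
- exact: inner_outer_regular_bigcup.
Qed.

(** With the regular sets as measurable sets, the closure properties of measurable functions prove
    the regularity of evaluation events. *)
Let TT := g_sigma_algebraType inner_outer_regular.
Let mTT (G : set (meas S)) :
  measurable (G : set TT) = inner_outer_regular G.
Proof.
by rewrite -[in RHS](sigma_algebra_id inner_outer_regular_sigma).
Qed.

Let mlocfin : measurable (@locfin R S : set TT).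
Proof.
rewrite mTT; split.
  rewrite (_ : _ @^-1` _ = setT); first exact: measurableT.
  by apply/seteqP; split => // w _; exact: fN.
move=> eps eps0; exists (@locfin R S), set0, set0; split => //.
- exact: coord_closedT.
- exact: coord_closed0.
- by split => // [|w _]; [rewrite measure0 lte_fin|left; exact: fN].
Qed.

Lemma measurable_coord_random (X : set (Borel S)) : measurable X ->
  measurable_fun setT (fun w => coord (N w) X).
Proof. by move=> mX; apply: measurableT_comp (mN mX). Qed.

(** Among locally finite measures the ray is closed. Its complement is approximated by the closed
    sets where the mass is at most [t - m.+1%:R^-1]; the events in between decrease to the empty
    set. *)
Lemma inner_outer_regular_ray i t :
  inner_outer_regular [set mu | t <= coord mu (e i)].
Proof.
have mX := measurable_coord_random (ds_measurable ds (ds_mem ds i)).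
split.
  have := mX measurableT `[t, +oo[%classic (measurable_itv _).
  rewrite setTI; congr measurable.
  by apply/seteqP; split => w /=; rewrite in_itv /= andbT.
move=> eps eps0.
pose Z n := (fun w => coord (N w) (e i)) @^-1` `]t - n.+1%:R^-1, t[%classic.
have mZ n : measurable (Z n).
  by rewrite -[Z n]setTI; apply: mX => //; exact: measurable_itv.
have Z0 : (fun n => P (Z n)) @ \oo --> 0%E.
  rewrite -(measure0 P) (_ : set0 = \bigcap_n Z n).
    apply: nonincreasing_cvg_mu => //.
    + by rewrite ltey_eq fin_num_measure.
    + exact: bigcapT_measurable.
    + apply/nonincreasing_seqP => n; apply/subsetPset => w; rewrite /Z /= !in_itv /=.
      move=> /andP[h ->]; rewrite andbT; apply: le_lt_trans h.
      by rewrite lerB// lef_pV2 ?posrE// ler_nat.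
  apply/seteqP; split => // w h.
  have := h 0%N Logic.I; rewrite /Z /= in_itv /= => /andP[_ wt].
  have [n] : exists n, n.+1%:R^-1 < t - coord (N w) (e i).
    have tw0 : 0 < t - coord (N w) (e i) by rewrite subr_gt0.
    have [n _ /(_ n (leqnn n))] := near_infty_natSinv_lt (PosNum tw0).
    by exists n.
  have := h n Logic.I; rewrite /Z /= in_itv /= => /andP[+ _].
  by rewrite ltrBlDr -ltrBlDl => /ltW /le_lt_trans/[apply]; rewrite ltxx.
have [m PZm] : exists m, (P (Z m) < eps%:E)%E.
  have /fine_cvg/cvgrPdist_lt/(_ _ eps0)[m _ /(_ m (leqnn m))] := Z0.
  rewrite /= sub0r normrN ger0_norm ?fine_ge0// => h; exists m.
  by rewrite -[P _]fineK ?fin_num_measure.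
have m0 : 0 < m.+1%:R^-1 :> R by rewrite invr_gt0.
exists [set mu | locfin mu /\ t <= coord mu (e i)],
  [set mu | locfin mu /\ coord mu (e i) <= t - m.+1%:R^-1], (Z m); split.
- split => [mu []//|nu fnu h]; split => //; apply/ler_addgt0Pr => e' e'0.
  have [nu' [_ tnu'] /(_ i (leqnn _)) h'] := h i.+1 e' e'0.
  apply: (le_trans tnu'); rewrite -lerBlDl.
  by apply: le_trans (ltW h'); rewrite ler_norm.
- split => [mu []//|nu fnu h]; split => //; apply/ler_addgt0Pr => e' e'0.
  have [nu' [_ tnu'] /(_ i (leqnn _)) h'] := h i.+1 e' e'0.
  rewrite -lerBlDr; apply: le_trans tnu'; rewrite lerBlDl -lerBlDr.
  by apply: le_trans (ltW h'); rewrite distrC ler_norm.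
- by move=> mu [].
- move=> mu [_ h] /= /le_trans/(_ h); apply/negP; rewrite -ltNge.
  by rewrite ltrBlDr ltrDl.
split => // w nZw.
have [h|h] := leP t (coord (N w) (e i)); first by left.
right; split => //; rewrite leNgt; apply/negP => h'.
by apply: nZw; rewrite /Z /= in_itv /= h' h.
Qed.

Lemma measurable_coord_TT (X : set S) : I X ->
  measurable_fun setT (fun mu : TT => coord mu X).
Proof.
move=> /(ds_enum ds)[i ->].
apply: (measurability (@RGenCInfty.G R)) => [|/= _ [_ [t ->]] <-].
  exact: RGenCInfty.measurableE.
rewrite setTI mTT (_ : _ @^-1` _ = [set mu | t <= coord mu (e i)]).
  exact: inner_outer_regular_ray.
by apply/seteqP; split => mu /=; rewrite in_itv /= andbT.
Qed.

Lemma measurable_ring_TT (D : set S) : in_ring I D ->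
  measurable_fun (@locfin R S : set TT) (fun mu : TT => mu D).
Proof.
move=> rD; have [|t [ut It dt st ct]] := @ring_refine _ _ Isr [:: D].
  by move=> A; rewrite mem_seq1 => /eqP ->.
have mt A (At : A \in t) := ds_measurable ds (It A At).
have {}st := st _ (mem_head _ _); have {}ct := ct _ (mem_head _ _).
pose f (mu : TT) := ((\sum_(B <- t) if (B \in t) && `[< B `<=` D >]
  then (coord mu B)%:E else 0)%R : \bar R)%E.
apply: (eq_measurable_fun f) => [mu|]; last first.
  apply: emeasurable_sum => B.
  case: (boolP ((B \in t) && `[< B `<=` D >])) => [/andP[/It IB _]|_]; last first.
    exact: measurable_cst.
  by apply: measurable_funTS; apply/measurable_EFinP; exact: measurable_coord_TT.
rewrite inE => fmu; rewrite (@measure_blocks _ (Borel S) R mu t _ ut mt dt st ct).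
rewrite [RHS]big_mkcond /f big_seq [RHS]big_seq; apply: eq_bigr => B Bt.
rewrite Bt /=; case: ifP => // _; rewrite /coord fineK// ge0_fin_numE//.
exact: (locfin_lty ds fmu (It _ Bt)).
Qed.

(** Intersecting with [D] keeps masses finite, so that complements become subtractions in the Dynkin
    induction from [I]. *)
Lemma measurable_evalI_TT (D : set S) (B : set (Borel S)) : in_ring I D ->
  measurable B ->
  measurable_fun (@locfin R S : set TT) (fun mu : TT => mu (B `&` D)).
Proof.
move=> rD; rewrite -Igen; move: B.
have mD := ds_ring_measurable ds rD.
have lty (mu : meas S) (A : set (Borel S)) : locfin mu -> measurable A ->
    mu (A `&` D) \is a fin_num.
  move=> fmu mA; rewrite ge0_fin_numE//.
  have muD : (mu D < +oo)%E by apply: (ring_lty ds) => // X; exact: (locfin_lty ds).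
  apply: le_lt_trans muD.
  by apply: le_measure; rewrite ?inE//; exact: measurableI.
apply: (@dynkin_induction _ (Borel S)).
- by rewrite Igen.
- by case: Isr.
- by rewrite setTI; exact: measurable_ring_TT.
- move=> X IX; apply: measurable_ring_TT; apply: (in_ringI Isr) => //.
  exact: in_ring_sub.
- move=> A mA ihA.
  apply: (eq_measurable_fun (fun mu : TT => mu D - mu (A `&` D))%E).
    move=> mu; rewrite inE => fmu.
    have -> : mu D = (mu (D `\` A) + mu (D `&` A))%E by exact: measureDI.
    rewrite [D `&` A]setIC addeK ?lty//; congr (mu _).
    by rewrite setDE setIC.
  by apply: emeasurable_funB => //; exact: measurable_ring_TT.
- move=> F mF tF ihF.
  apply: (eq_measurable_fun
    (fun mu : TT => (\sum_(0 <= i <oo | i \in predT) mu (F i `&` D))%E)).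
    move=> mu _; rewrite setI_bigcupl measure_semi_bigcup//.
    + by move=> i; exact: measurableI.
    + exact: trivIset_setIr.
    + by rewrite -setI_bigcupl; apply: measurableI => //; exact: bigcupT_measurable.
  by apply: ge0_emeasurable_sum => // i _; exact: ihF.
Qed.

Lemma measurable_eval_TT (B : set (Borel S)) : measurable B ->
  measurable_fun (@locfin R S : set TT) (fun mu : TT => mu B).
Proof.
(* The space is cut into countably many disjoint ring sets, to each of which the finite case
   applies. *)
move=> mB; pose D := seqDU e.
have rD k : in_ring I (D k).
  apply: in_ringD => //; first exact/in_ring_sub/(ds_mem ds).
  rewrite -bigcup_mkord; apply: in_ring_bigcup => // i.
  exact/in_ring_sub/(ds_mem ds).
have mD k := ds_ring_measurable ds (rD k).
apply: (eq_measurable_fun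
  (fun mu : TT => (\sum_(0 <= i <oo | i \in predT) mu (B `&` D i))%E)).
  move=> mu _; rewrite -[in RHS](setIT B) -(ds_total ds) (seqDU_bigcup_eq e).
  rewrite setI_bigcupr measure_semi_bigcup//.
  + by move=> i; exact: measurableI.
  + by apply: trivIset_setIl; exact: trivIset_seqDU.
  + apply: bigcupT_measurable => i; exact: measurableI.
by apply: ge0_emeasurable_sum => // i _; exact: measurable_evalI_TT.
Qed.

(** Complements in [ev_sigma] are relative to the locally finite measures, themselves a regular set,
    so they are differences of regular sets. *)
Lemma ev_sigma_regular (A : set S) (E : set (meas S)) :
  ev_sigma A E -> inner_outer_regular E.
Proof.
move: E; apply: smallest_sub => [|_ [B [U [mB _ mU ->]]]]; last first.
  by rewrite -mTT; exact: (measurable_eval_TT mB).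
split.
- by rewrite -mTT; exact: measurable0.
- by move=> G; rewrite -!mTT => mG; exact: measurableD.
- by move=> F rF; exact: inner_outer_regular_bigcup.
Qed.

End regularity.

(** * Expectations of bounded random variables *)

Section bounded_expectation.
Context (R : realType) d (Omega : measurableType d) (P : probability Omega R).
Implicit Types X Y Z : Omega -> R.

Definition bounded_rv X :=
  measurable_fun setT X /\ exists c, forall w, `|X w| <= c.

Local Notation EE X := (\int[P]_w X w).

Lemma bounded_rv_integrable X : bounded_rv X -> P.-integrable setT (EFin \o X).
Proof.
move=> [mX [c Xc]].
apply: (@le_integrable _ _ _ _ _ measurableT _ (EFin \o cst c)).
- exact/measurable_EFinP.
- by move=> w _ /=; rewrite lee_fin (le_trans (Xc w)) ?ler_norm.
- by apply: finite_measure_integrable_cst.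
Qed.

Lemma ExpE X : bounded_rv X -> Exp P X = (EE X)%:E.
Proof.
by move=> bX; rewrite fineK//; apply: integrable_fin_num => //;
  exact: bounded_rv_integrable.
Qed.

Lemma bounded_rv_cst c : bounded_rv (fun=> c).
Proof. by split => //; exists `|c|. Qed.

Lemma bounded_rvD X Y : bounded_rv X -> bounded_rv Y ->
  bounded_rv (fun w => X w + Y w).
Proof.
move=> [mX [a Xa]] [mY [b Yb]]; split; first exact: measurable_funD.
by exists (a + b) => w; apply: le_trans (ler_normD _ _) _; exact: lerD.
Qed.

Lemma bounded_rvM X Y : bounded_rv X -> bounded_rv Y ->
  bounded_rv (fun w => X w * Y w).
Proof.
move=> [mX [a Xa]] [mY [b Yb]]; split; first exact: measurable_funM.
by exists (a * b) => w; rewrite normrM ler_pM.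
Qed.

Lemma bounded_rvZ c X : bounded_rv X -> bounded_rv (fun w => c * X w).
Proof. by move=> bX; apply: bounded_rvM => //; exact: bounded_rv_cst. Qed.

Lemma bounded_rvB X Y : bounded_rv X -> bounded_rv Y ->
  bounded_rv (fun w => X w - Y w).
Proof.
move=> bX [mY [b Yb]]; apply: bounded_rvD => //; split.
  exact: measurableT_comp.
by exists b => w; rewrite normrN.
Qed.

Lemma bounded_rv_norm X : bounded_rv X -> bounded_rv (fun w => `|X w|).
Proof.
move=> [mX [a Xa]]; split; first exact: measurableT_comp.
by exists a => w; rewrite normr_id.
Qed.

Lemma bounded_rv_indic (A : set Omega) : measurable A -> bounded_rv \1_A.
Proof.
move=> mA; split; first exact: measurable_indic.
by exists 1 => w; rewrite indicE; case: (w \in A); rewrite /= ?normr1 ?normr0.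
Qed.

Lemma mean_le X Y : bounded_rv X -> bounded_rv Y -> (forall w, X w <= Y w) ->
  EE X <= EE Y.
Proof. by move=> bX bY XY; apply: le_Rintegral => //; exact: bounded_rv_integrable. Qed.

Lemma mean_D X Y : bounded_rv X -> bounded_rv Y ->
  EE (fun w => X w + Y w) = EE X + EE Y.
Proof. by move=> bX bY; rewrite RintegralD//; exact: bounded_rv_integrable. Qed.

Lemma mean_B X Y : bounded_rv X -> bounded_rv Y ->
  EE (fun w => X w - Y w) = EE X - EE Y.
Proof. by move=> bX bY; rewrite RintegralB//; exact: bounded_rv_integrable. Qed.

Lemma mean_Z c X : bounded_rv X -> EE (fun w => c * X w) = c * EE X.
Proof. by move=> bX; rewrite RintegralZl//; exact: bounded_rv_integrable. Qed.

Lemma mean_cst c : EE (fun=> c) = c.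
Proof. by rewrite Rintegral_cst//= probability_setT mulr1. Qed.

Lemma mean_indic (A : set Omega) : measurable A -> EE \1_A = fine (P A).
Proof. by move=> mA; rewrite /Rintegral integral_indic// setIT. Qed.

Lemma mean_norm X : bounded_rv X -> `|EE X| <= EE (fun w => `|X w|).
Proof. by move=> bX; apply: le_normr_Rintegral => //; exact: bounded_rv_integrable. Qed.

Lemma mean_cvg0 (X : nat -> Omega -> R) :
    (forall n, measurable_fun setT (X n)) -> (forall n w, 0 <= X n w <= 1) ->
    (forall w, X ^~ w @ \oo --> 0) ->
  forall eps, 0 < eps -> exists n, EE (X n) < eps.
Proof.
move=> mX X01 X0 eps eps0.
have bX n : bounded_rv (X n).
  by split => //; exists 1 => w; rewrite ger0_norm; have /andP[] := X01 n w.
have [|//||||_ _ cX] := @dominated_convergence _ _ _ P setT measurableT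
  (fun n => EFin \o X n) (cst 0%E) (EFin \o cst 1).
- by move=> n; exact/measurable_EFinP.
- by apply: aeW => w _; apply: cvg_EFin; [exact: nearW|exact: X0].
- exact: finite_measure_integrable_cst.
- apply: aeW => w n _ /=; rewrite lee_fin ger0_norm; by have /andP[] := X01 n w.
move: cX; rewrite integral0 => /fine_cvg/cvgrPdist_lt/(_ _ eps0).
move=> [n _ /(_ n (leqnn n))]; rewrite /= sub0r normrN => h; exists n.
exact: le_lt_trans (ler_norm _) h.
Qed.

Definition cov X Y := EE (fun w => X w * Y w) - EE X * EE Y.

(** From X Y - X' Y' = X (Y - Y') + Y' (X - X'), so that only bounds on [X] and [Y'] enter. The
    factor 2 accounts for the mean of the product and the product of the means. *)
Lemma cov_close X Y X' Y' c c' : bounded_rv X -> bounded_rv Y ->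
    bounded_rv X' -> bounded_rv Y' ->
    (forall w, `|X w| <= c) -> (forall w, `|Y' w| <= c') ->
  `|cov X Y - cov X' Y'| <=
    2 * (c * EE (fun w => `|Y w - Y' w|) + c' * EE (fun w => `|X w - X' w|)).
Proof.
move=> bX bY bX' bY' Xc Yc'.
have bXX := bounded_rvB bX bX'; have bYY := bounded_rvB bY bY'.
have nX := bounded_rv_norm bXX; have nY := bounded_rv_norm bYY.
have absX : `|EE X| <= c.
  apply: le_trans (mean_norm bX) _; rewrite -[leRHS]mean_cst.
  by apply: mean_le => //; [exact: bounded_rv_norm|exact: bounded_rv_cst].
have absY : `|EE Y'| <= c'.
  apply: le_trans (mean_norm bY') _; rewrite -[leRHS]mean_cst.
  by apply: mean_le => //; [exact: bounded_rv_norm|exact: bounded_rv_cst].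
have h1 : `|EE (fun w => X w * Y w) - EE (fun w => X' w * Y' w)| <=
    c * EE (fun w => `|Y w - Y' w|) + c' * EE (fun w => `|X w - X' w|).
  rewrite -mean_B; [|exact: bounded_rvM..].
  apply: le_trans (mean_norm _) _.
    by apply: bounded_rvB; exact: bounded_rvM.
  rewrite -mean_Z// -mean_Z// -mean_D; [|exact: bounded_rvZ..].
  apply: mean_le.
  - by apply: bounded_rv_norm; apply: bounded_rvB; exact: bounded_rvM.
  - by apply: bounded_rvD; exact: bounded_rvZ.
  - move=> w; have -> : X w * Y w - X' w * Y' w =
      X w * (Y w - Y' w) + Y' w * (X w - X' w) by ring.
    apply: le_trans (ler_normD _ _) _; rewrite !normrM.
    by apply: lerD; apply: ler_wpM2r.
have h2 : `|EE X * EE Y - EE X' * EE Y'| <=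
    c * EE (fun w => `|Y w - Y' w|) + c' * EE (fun w => `|X w - X' w|).
  have -> : EE X * EE Y - EE X' * EE Y' =
      EE X * (EE Y - EE Y') + EE Y' * (EE X - EE X') by ring.
  apply: le_trans (ler_normD _ _) _; rewrite !normrM -!mean_B//.
  by apply: lerD; apply: ler_pM => //; exact: mean_norm.
have -> : cov X Y - cov X' Y' =
    (EE (fun w => X w * Y w) - EE (fun w => X' w * Y' w)) -
    (EE X * EE Y - EE X' * EE Y') by rewrite /cov; ring.
apply: le_trans (ler_normB _ _) _; rewrite mulr_natl mulr2n; exact: lerD.
Qed.

End bounded_expectation.

(** * Measurability of Lipschitz functions of finitely many coordinates *)

Section lipschitz_measurable.
Context (R : realType) (J : eqType) (Js : seq J) (L : R) (h : (J -> R) -> R).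
Hypothesis L0 : 0 <= L.
Hypothesis hL : forall x y, `|h x - h y| <= L * \sum_(j <- Js) `|x j - y j|.

(* [h < t] is a countable union, over rational points [q] and radii [r] with
   [h q + r < t], of the sets of points at weighted distance at most [r] of [q]. *)
Lemma lipschitz_measurable d (T : measurableType d) (x : T -> J -> R) :
    (forall j, j \in Js -> measurable_fun setT (x^~ j)) ->
  measurable_fun setT (fun w => h (x w)).
Proof.
move=> mx; apply: (measurability (@RGenInftyO.G R)) => [|/= _ [_ [t ->]] <-].
  exact: RGenInftyO.measurableE.
rewrite setTI.
(* Only coordinates in [Js] count, so the rational points are coded by the countable type of lists,
   the entry for [j] being at its index in [Js]. *)
pose pt (q : seq rat) (j : J) : R := ratr (nth 0 q (index j Js)).
pose dist q w := L * \sum_(j <- Js) `|x w j - pt q j|.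
have mdist q : measurable_fun setT (dist q).
  apply: measurable_funM => //.
  rewrite (_ : (fun w => _) = fun w =>
    \sum_(j <- Js) if j \in Js then `|x w j - pt q j| else 0).
    apply: measurable_sum => j; case: (boolP (j \in Js)) => [/mx mj|_ //].
    by apply: measurableT_comp => //; exact: measurable_funB.
  by apply/funext => w; rewrite big_seq [RHS]big_seq; apply: eq_bigr => j ->.
rewrite (_ : _ @^-1` _ = \bigcup_(p in
    [set p : seq rat * rat | h (pt p.1) + ratr p.2 < t]) (dist p.1 @^-1` `]-oo, ratr p.2])).
  rewrite bigcup_mkcond; apply: countable_bigcupT_measurable => [|p].
    exact: countableP.
  case: ifP => // _.
  by rewrite -[X in measurable X]setTI; apply: mdist => //; exact: measurable_itv.
apply/seteqP; split => w /=; rewrite in_itv /=; last first.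
  move=> [[q r] /= qr]; rewrite in_itv /= => dr.
  apply: le_lt_trans qr; rewrite -lerBlDl; apply: le_trans dr.
  by apply: le_trans (ler_norm _) (hL _ _).
move=> hwt.
(* Half of the gap, because [r] is spent twice: passing from [h (x w)] to [h] at the rational point,
   and in the condition on [h q + r]. *)
have [r] := @rat_in_itvoo R 0 ((t - h (x w)) / 2) ltac:(by rewrite divr_gt0// subr_gt0).
rewrite in_itv /= => /andP[r0 rt].
pose n := size Js.
(* An error [del] in each of the [n] coordinates keeps the weighted distance below [r]; the added 1
   covers [L * n%:R = 0]. *)
pose del : R := ratr r / (L * n%:R + 1).
have LnR : 0 < L * n%:R + 1 by rewrite ltr_wpDl// mulr_ge0.
have del0 : 0 < del by rewrite divr_gt0.
have /choice[q qP] : forall j, exists q : rat, `|x w j - ratr q| <= del.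
  move=> j.
  have [q] := @rat_in_itvoo R (x w j - del) (x w j + del)
    ltac:(by rewrite ltrD2l gtrN).
  rewrite in_itv /= => /andP[q1 q2]; exists q.
  by rewrite distrC ler_distl; apply/andP; split; apply/ltW.
have dr : dist (map q Js) w <= ratr r.
  apply: (@le_trans _ _ (L * (n%:R * del))).
    apply: ler_wpM2l => //.
    apply: (@le_trans _ _ (\sum_(j <- Js) del)).
      rewrite big_seq [leRHS]big_seq; apply: ler_sum => j jJs.
      by rewrite /pt (nth_map j) ?index_mem// nth_index.
    by rewrite big_const_seq count_predT iter_addr_0 mulr_natl.
  rewrite mulrA /del mulrCA ler_piMr//; first exact/ltW.
  by rewrite ler_pdivrMr// mul1r lerDl.
exists (map q Js, r) => /=; last by rewrite in_itv.
have := hL (pt (map q Js)) (x w); under eq_bigr do rewrite distrC.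
move=> /(le_trans (ler_norm _))/le_trans/(_ dr); rewrite lerBlDr.
move: rt; rewrite ltr_pdivlMr// mulr_natr mulr2n => rt hq.
apply: (@le_lt_trans _ _ (ratr r + h (x w) + ratr r)); first by rewrite lerD2r.
by rewrite addrAC -ltrBrDr.
Qed.

End lipschitz_measurable.

(** The previous lemma for the identity of [K -> R] with the sigma-algebra generated by its
    coordinates. *)
Lemma lipschitz_vec_sigma (R : realType) (K : finType) (L : R)
    (h : (K -> R) -> R) : 0 <= L ->
    (forall x y, `|h x - h y| <= L * \sum_k `|x k - y k|) ->
  forall U : set R, measurable U -> @vec_sigma R K (h @^-1` U).
Proof.
move=> L0 hL U mU.
pose G := [set E | exists (k : K) (V : set R),
  measurable V /\ E = (fun x : K -> R => x k) @^-1` V].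
pose T : measurableType _ := g_sigma_algebraType G.
have := @lipschitz_measurable R K (index_enum K) L h L0 hL _ T id _ measurableT U mU.
rewrite setTI; apply => k _ _ V mV; rewrite setTI; apply: sub_gen_smallest.
by exists k, V.
Qed.

(** * Approximation by Lipschitz cylinder functions *)

Section cylinder_approximation.
Context (R : realType) (S : pseudoPMetricType R).
Context (I : set (set S)) (e : nat -> set S).
Hypothesis ds : dissecting_system I e.

(* The argument [x X] of [h] stands for the mass [mu X]. *)
Definition lip_cylinder (h : (set S -> R) -> R) (Xs : seq (set S)) (L c : R) :=
  [/\ 0 <= L, (forall X, X \in Xs -> I X), (forall x, `|h x| <= c),
    (forall x y, (forall X, X \in Xs -> x X <= y X) -> h x <= h y) &
    (forall x y, `|h x - h y| <= L * \sum_(X <- Xs) `|x X - y X|)].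

Lemma lip_cylinder_cst c : lip_cylinder (fun=> c) [::] 0 `|c|.
Proof. by split => // x y; rewrite subrr normr0 mul0r. Qed.

Lemma lip_cylinderZ h Xs L c k : 0 <= k -> lip_cylinder h Xs L c ->
  lip_cylinder (fun x => k * h x) Xs (k * L) (k * c).
Proof.
move=> k0 [L0 IX hc hm hL]; split => //.
- exact: mulr_ge0.
- by move=> x; rewrite normrM ger0_norm// ler_wpM2l.
- by move=> x y /hm; exact: ler_wpM2l.
- by move=> x y; rewrite -mulrBr normrM ger0_norm// -mulrA ler_wpM2l.
Qed.

Lemma lip_cylinderD h Xs L c h' Xs' L' c' :
    lip_cylinder h Xs L c -> lip_cylinder h' Xs' L' c' ->
  lip_cylinder (fun x => h x + h' x) (Xs ++ Xs') (L + L') (c + c').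
Proof.
move=> [L0 IX hc hm hL] [L'0 IX' hc' hm' hL']; split.
- exact: addr_ge0.
- by move=> X; rewrite mem_cat => /orP[/IX|/IX'].
- by move=> x; apply: le_trans (ler_normD _ _) _; exact: lerD.
- move=> x y xy; apply: lerD; [apply: hm|apply: hm'] => X XX; apply: xy.
    by rewrite mem_cat XX.
  by rewrite mem_cat XX orbT.
- move=> x y; rewrite opprD addrACA; apply: le_trans (ler_normD _ _) _.
  rewrite big_cat /= mulrDl; apply: lerD.
    apply: le_trans (hL _ _) _; apply: ler_wpM2l => //.
    by rewrite lerDl; apply: sumr_ge0.
  apply: le_trans (hL' _ _) _; apply: ler_wpM2l => //.
  by rewrite lerDr; apply: sumr_ge0.
Qed.

Section upset.
Variables (F : set (meas S)) (n : nat).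

Let Xs := [seq e i | i <- iota 0 n].
(** Only an excess of [nu] over [x] counts, which makes the tent non-decreasing in [x]. The factor
    [n] narrows it: where it is positive, some [nu] in [F] exceeds [x] by at most 1/n in each
    coordinate. *)
Let gap (nu : meas S) (x : set S -> R) :=
  n%:R * \sum_(X <- Xs) Num.max 0 (coord nu X - x X).
Let val nu x := Num.max 0 (1 - gap nu x).
(** The value 0 keeps this set nonempty, hence its supremum meaningful, when [F] is empty. *)
Let A x := [set 0] `|` [set val nu x | nu in F].

(* The tent function over the up-closure of [F] in the first [n] coordinates. *)
Definition upset_tent (x : set S -> R) := sup (A x).

Let gap_ge0 nu x : 0 <= gap nu x.
Proof. by apply: mulr_ge0 => //; apply: sumr_ge0 => X _; rewrite le_max lexx. Qed.

Let val01 nu x : 0 <= val nu x <= 1.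
Proof.
rewrite /val le_max lexx /= ge_max ler01 /=.
by rewrite lerBlDr lerDl gap_ge0.
Qed.

Let A_ubound x : has_ubound (A x).
Proof.
exists 1 => _ [->|[nu _ <-]]; first exact: ler01.
by have /andP[] := val01 nu x.
Qed.

Let le_tent nu x : F nu -> val nu x <= upset_tent x.
Proof. by move=> Fnu; apply: ub_le_sup; [exact: A_ubound|right; exists nu]. Qed.

Let tent_ge0 x : 0 <= upset_tent x.
Proof. by apply: ub_le_sup; [exact: A_ubound|left]. Qed.

Let tent_le x b : 0 <= b -> (forall nu, F nu -> val nu x <= b) ->
  upset_tent x <= b.
Proof.
move=> b0 h; apply: ge_sup; first by exists 0; left.
by move=> _ [->//|[nu /h + <-]].
Qed.

Lemma upset_tent01 x : 0 <= upset_tent x <= 1.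
Proof.
rewrite tent_ge0 /=; apply: tent_le => // nu _.
by have /andP[] := val01 nu x.
Qed.

Lemma upset_tent1 mu : F mu -> upset_tent (coord mu) = 1.
Proof.
move=> Fmu; apply/eqP; rewrite eq_le; have /andP[_ ->] /= := upset_tent01 (coord mu).
apply: le_trans (le_tent (coord mu) Fmu); rewrite /val /gap.
rewrite big1 ?mulr0 ?subr0; first by rewrite le_max lexx orbT.
by move=> X _; rewrite subrr maxxx.
Qed.

Lemma upset_tent_gt0 x : 0 < upset_tent x -> exists2 nu, F nu &
  forall i, (i < n)%N -> coord nu (e i) <= x (e i) + n%:R^-1.
Proof.
move=> h; apply: contrapT => nF.
have : upset_tent x <= 0.
  apply: tent_le => // nu Fnu; rewrite /val ge_max lexx /= leNgt subr_gt0.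
  apply/negP => gap1; apply: nF; exists nu => // i iN.
  have n0 : 0 < n%:R :> R by rewrite ltr0n (leq_ltn_trans _ iN).
  rewrite -lerBlDl -[leRHS]mulr1 ler_pdivlMl//; apply/ltW; apply: le_lt_trans gap1.
  apply: ler_wpM2l; first exact/ltW.
  have iXs : e i \in Xs by apply: map_f; rewrite mem_iota.
  apply: (@le_trans _ _ (Num.max 0 (coord nu (e i) - x (e i)))).
    by rewrite le_max lexx orbT.
  rewrite (perm_big _ (perm_to_rem iXs)) big_cons lerDl.
  by apply: sumr_ge0 => X _; rewrite le_max lexx.
by rewrite leNgt h.
Qed.

Lemma upset_tent_lip : lip_cylinder upset_tent Xs n%:R 1.
Proof.
have max_lip (a b c : R) :
    Num.max 0 (a - b) <= Num.max 0 (a - c) + `|b - c|.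
  rewrite ge_max; apply/andP; split; first by rewrite addr_ge0// le_max lexx.
  apply: (@le_trans _ _ ((a - c) + `|b - c|)); last by rewrite lerD2r le_max lexx orbT.
  by have := ler_norm (c - b); rewrite distrC; lra.
have half x y : upset_tent x <= upset_tent y + n%:R * \sum_(X <- Xs) `|x X - y X|.
  apply: tent_le => [|nu Fnu].
    by rewrite addr_ge0//; apply: mulr_ge0 => //; apply: sumr_ge0.
  apply: (@le_trans _ _ (val nu y + n%:R * \sum_(X <- Xs) `|x X - y X|)); last first.
    by rewrite lerD2r; exact: le_tent.
  rewrite {1}/val ge_max; apply/andP; split.
    rewrite addr_ge0//; first by have /andP[] := val01 nu y.
    by apply: mulr_ge0 => //; apply: sumr_ge0.
  apply: (@le_trans _ _ ((1 - gap nu y) + n%:R * \sum_(X <- Xs) `|x X - y X|)).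
    rewrite -addrA lerD2l lerNl opprD opprK lerBlDr /gap -mulrDr.
    apply: ler_wpM2l => //; rewrite -big_split /=; apply: ler_sum => X _.
    by rewrite distrC.
  by rewrite lerD2r /val le_max lexx orbT.
split => //.
- by move=> X /mapP[i _ ->]; exact: (ds_mem ds).
- by move=> x; have /andP[h0 h1] := upset_tent01 x; rewrite ger0_norm.
- move=> x y xy; apply: tent_le => // nu Fnu; apply: le_trans (le_tent y Fnu).
  rewrite /val ge_max le_max lexx /= le_max; apply/orP; right.
  rewrite lerB// /gap; apply: ler_wpM2l => //.
  rewrite big_seq [leRHS]big_seq; apply: ler_sum => X XXs.
  by rewrite ge_max !le_max lexx /= lerB ?orbT// xy.
- move=> x y; rewrite ler_distl; apply/andP; split; last exact: half.
  rewrite lerBlDr; have := half y x.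
  by under eq_bigr do rewrite distrC.
Qed.

End upset.

Lemma upset_tent_eq0 (F U : set (meas S)) (y : meas S) :
    coord_closed e F -> F `<=` U -> locfin y -> ~ U y ->
    (forall mu, U mu -> locfin mu -> meas_le mu y -> U y) ->
  exists n0, forall n, (n0 <= n)%N -> upset_tent F n (coord y) = 0.
Proof.
move=> [Ff cF] FU fy nUy Uy; apply: contrapT => /forallNP h.
(* A tent that is nonzero at some [n] beyond [m.+1] gives a slack 1/n, within the one that
   [dominated_limit] allows at index [m]. *)
have {}h m : exists nu, F nu /\ forall i, (i < m)%N ->
    fine (nu (e i)) <= fine (y (e i)) + m.+1%:R^-1.
  have /existsNP[n /not_implyP[mn nz]] := h m.+1.
  have /andP[t0 _] := upset_tent01 F n (coord y).
  have [|nu Fnu hnu] := @upset_tent_gt0 F n (coord y).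
    by rewrite lt_neqAle t0 andbT eq_sym; apply/eqP.
  exists nu; split => // i im; apply: le_trans (hnu i _) _.
    by apply: leq_trans mn; exact: leq_trans im _.
  by rewrite lerD2l lef_pV2 ?posrE ?ltr0n ?ler_nat//; exact: leq_trans mn.
move/choice : h => [nu_ hnu].
have [|nu [fnu nuy cnu]] := dominated_limit ds _ fy (fun n => (hnu n).2).
  by move=> n; apply: Ff; exact: (hnu n).1.
apply: nUy; apply: (Uy nu) => //; apply: FU; apply: cF => // n eps eps0.
have [m hm] := cnu n eps eps0.
by exists (nu_ m) => //; exact: (hnu m).1.
Qed.

(** * Approximation of test functions in mean *)

Section approximation.
Context d (Omega : measurableType d) (P : probability Omega R).
Variable N : Omega -> meas S.
Hypothesis rN : random_measure P N.

Let fN w : locfin (N w). Proof. by case: rN. Qed.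

Lemma bounded_rv_lip h Xs L c : lip_cylinder h Xs L c ->
  bounded_rv (fun w => h (coord (N w))).
Proof.
move=> [L0 IX hc _ hL]; split; last by exists c.
apply: (lipschitz_measurable L0 hL) => X XXs.
by apply: (measurable_coord_random rN); apply: (ds_measurable ds); exact: IX.
Qed.

Definition lip_approximable (X : Omega -> R) := bounded_rv X /\
  forall eps, 0 < eps -> exists h Xs L c, lip_cylinder h Xs L c /\
    \int[P]_w `|X w - h (coord (N w))| <= eps.

Lemma lip_approximable_cst c : lip_approximable (fun=> c).
Proof.
split; first exact: bounded_rv_cst.
move=> eps eps0; exists (fun=> c), [::], 0, `|c|; split.
  exact: lip_cylinder_cst.
by rewrite subrr normr0 mean_cst ltW.
Qed.

Lemma lip_approximableZ k X : 0 < k -> lip_approximable X ->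
  lip_approximable (fun w => k * X w).
Proof.
move=> k0 [bX aX]; split; first exact: bounded_rvZ.
move=> eps eps0; have [|h [Xs [L [c [lh hX]]]]] := aX (eps / k).
  exact: divr_gt0.
exists (fun x => k * h x), Xs, (k * L), (k * c); split.
  by apply: lip_cylinderZ => //; exact: ltW.
under eq_Rintegral do rewrite -mulrBr normrM (gtr0_norm k0).
rewrite mean_Z -?ler_pdivlMl 1?mulrC//.
apply: bounded_rv_norm; apply: bounded_rvB => //; exact: bounded_rv_lip lh.
Qed.

Lemma lip_approximableD X Y : lip_approximable X -> lip_approximable Y ->
  lip_approximable (fun w => X w + Y w).
Proof.
move=> [bX aX] [bY aY]; split; first exact: bounded_rvD.
move=> eps eps0; have e20 : 0 < eps / 2 by rewrite divr_gt0.
have [h [Xs [L [c [lh hX]]]]] := aX _ e20.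
have [h' [Xs' [L' [c' [lh' hY]]]]] := aY _ e20.
exists (fun x => h x + h' x), (Xs ++ Xs'), (L + L'), (c + c'); split.
  exact: lip_cylinderD.
have b1 := bounded_rvB bX (bounded_rv_lip lh).
have b2 := bounded_rvB bY (bounded_rv_lip lh').
rewrite [eps]splitr; apply: le_trans (lerD hX hY).
rewrite -mean_D; [|exact: bounded_rv_norm..].
apply: mean_le.
- apply: bounded_rv_norm; apply: bounded_rvB; first exact: bounded_rvD.
  exact: bounded_rv_lip (lip_cylinderD lh lh').
- by apply: bounded_rvD; exact: bounded_rv_norm.
- by move=> w; rewrite opprD addrACA; exact: ler_normD.
Qed.

Lemma lip_approximable_unif X : bounded_rv X ->
    (forall eps, 0 < eps -> exists2 Y, lip_approximable Y &
      forall w, `|X w - Y w| <= eps) -> lip_approximable X.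
Proof.
move=> bX h; split => // eps eps0; have e20 : 0 < eps / 2 by rewrite divr_gt0.
have [Y [bY aY] XY] := h _ e20.
have [g [Xs [L [c [lg hY]]]]] := aY _ e20.
exists g, Xs, L, c; split => //.
have bg := bounded_rv_lip lg.
have b1 := bounded_rvB bY bg.
rewrite [eps]splitr; apply: le_trans (lerD (lexx _) hY).
rewrite -[X in X + _](mean_cst P) -mean_D; last 2 first.
- exact: bounded_rv_cst.
- exact: bounded_rv_norm.
apply: mean_le.
- by apply: bounded_rv_norm; exact: bounded_rvB.
- by apply: bounded_rvD; [exact: bounded_rv_cst|exact: bounded_rv_norm].
- move=> w; rewrite -(subrKA (Y w)); apply: le_trans (ler_normD _ _) _.
  by rewrite lerD2r.
Qed.

(** Off [Z] the tent is exact on [U], being 1 on [F]; its overshoot [v n] outside [U] is eventually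
    0 at each point, so its mean is small by dominated convergence. On [Z] the error is at most
    1. *)
Lemma lip_approximable_upset (U : set (meas S)) :
    inner_outer_regular e P N U ->
    (forall mu nu, U mu -> locfin mu -> locfin nu -> meas_le mu nu -> U nu) ->
  lip_approximable (fun w => \1_(N @^-1` U) w).
Proof.
move=> [mU rU] upU; have bU := bounded_rv_indic R mU; split => // eps eps0.
have e20 : 0 < eps / 2 by rewrite divr_gt0.
have [F [C [Z [cF cC FU CU [mZ PZ FC]]]]] := rU _ e20.
pose t n w := upset_tent F n (coord (N w)).
have bt n : bounded_rv (t n) by exact: bounded_rv_lip (upset_tent_lip F n).
have mnU : measurable (N @^-1` (~` U)).
  by rewrite preimage_setC; exact: measurableC.
pose v n w := t n w * \1_(N @^-1` (~` U)) w.
have bv n : bounded_rv (v n).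
  by apply: bounded_rvM => //; exact: bounded_rv_indic.
have v01 n w : 0 <= v n w <= 1.
  rewrite /v indicE; have /andP[h0 h1] := upset_tent01 F n (coord (N w)).
  by case: (_ \in _); rewrite ?mulr1 ?mulr0 ?lexx ?ler01// /t h0.
have [n vn] : exists n, \int[P]_w v n w < eps / 2.
  apply: mean_cvg0 => // [n|w]; first by case: (bv n).
  have [Uw|nUw] := pselect (U (N w)).
    rewrite (_ : v^~ w = fun=> 0); first exact: cvg_cst.
    by apply/funext => n; rewrite /v indicE memNset ?mulr0//; apply.
  have [|n0 hn0] := @upset_tent_eq0 F U (N w) cF FU (fN w) nUw.
    by move=> mu Umu fmu; exact: upU.
  apply: cvg_near_cst; exists n0 => // n /hn0 h.
  by rewrite /v /t h mul0r.
exists (upset_tent F n), [seq e i | i <- iota 0 n], n%:R, 1.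
split; first exact: upset_tent_lip.
have bZ := bounded_rv_indic R mZ.
apply: (@le_trans _ _ (\int[P]_w (\1_Z w + v n w))).
  apply: mean_le.
  - by apply: bounded_rv_norm; apply: bounded_rvB => //; exact: bt.
  - exact: bounded_rvD.
  move=> w; rewrite -/(t n w) /v !indicE.
  have /andP[h0 h1] := upset_tent01 F n (coord (N w)).
  rewrite -/(t n w) in h0 h1.
  have [Zw|nZw] := pselect (Z w).
    rewrite (mem_set Zw) /=; apply: (@le_trans _ _ 1).
      by rewrite ler_distl; case: (w \in _) => /=; apply/andP; split; lra.
    by rewrite lerDl; case: (_ \in _); rewrite ?mulr1 ?mulr0.
  rewrite (memNset nZw) add0r; have [Fw|Cw] := FC _ nZw.
    have Uw : U (N w) by exact: FU.
    rewrite (mem_set (_ : (N @^-1` U) w))//.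
    rewrite (memNset (_ : ~ (N @^-1` (~` U)) w)); last by apply.
    by rewrite /t upset_tent1// subrr normr0 mulr0.
  have nUw : ~ U (N w) by exact: CU.
  rewrite (memNset (_ : ~ (N @^-1` U) w))// (mem_set (_ : (N @^-1` (~` U)) w))//.
  by rewrite sub0r normrN mulr1 ger0_norm.
rewrite mean_D// mean_indic// [eps]splitr; apply: lerD; last exact: ltW.
by rewrite -lee_fin fineK ?fin_num_measure// ltW.
Qed.

(** The sum counts the levels reached by [u]. The second conjunct, for [u] above the top level, is
    what the induction on [K] needs. *)
Lemma staircase (del u : R) (K : nat) : 0 < del -> 0 <= u ->
  let s := del * \sum_(k < K) (k.+1%:R * del <= u)%R%:R in
  (u <= K%:R * del -> s <= u <= s + del) /\ (K%:R * del <= u -> s = K%:R * del).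
Proof.
move=> del0 u0; elim: K => [|K [ih1 ih2]] /=.
  rewrite big_ord0 mulr0 mul0r; split => // u0'.
  have -> : u = 0 by apply/eqP; rewrite eq_le u0 u0'.
  by rewrite add0r lexx ltW.
rewrite big_ord_recr /= mulrDr.
have KK : K%:R * del <= K.+1%:R * del by rewrite ler_wpM2r ?ler_nat// ltW.
have full : K.+1%:R * del <= u ->
    del * (\sum_(k < K) (k.+1%:R * del <= u)%R%:R) +
    del * (K.+1%:R * del <= u)%R%:R = K.+1%:R * del.
  move=> h; rewrite h mulr1 ih2; last exact: le_trans h.
  by rewrite -[K.+1]addn1 natrD mulrDl mul1r.
split => // uK; have [h|h] := leP (K.+1%:R * del) u.
  have := full h; rewrite h => ->.
  by rewrite h (le_trans uK)// lerDl ltW.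
rewrite mulr0 addr0; have [h'|h'] := leP u (K%:R * del); first exact: ih1.
rewrite ih2; last exact: ltW.
rewrite (ltW h') /=; apply: le_trans (ltW h) _.
by rewrite -[K.+1]addn1 natrD mulrDl mul1r.
Qed.

Lemma bounded_rv_test (A : set S) f : meas_test_fun A f ->
  bounded_rv (fun w => f (N w)).
Proof.
move=> [[c fc] mf upf]; split; last by exists c => w; exact: fc.
move=> _ V mV; rewrite setTI.
have [+ _] := ev_sigma_regular ds rN (mf _ mV).
rewrite (_ : N @^-1` _ = (fun w => f (N w)) @^-1` V)//.
apply/seteqP; split => w /=; first by case.
by move=> h; split => //; exact: fN.
Qed.

Lemma lip_approximable_test (A : set S) f : meas_test_fun A f ->
  lip_approximable (fun w => f (N w)).
Proof.
move=> tf; have bf := bounded_rv_test tf; have [[c fc] mf upf] := tf.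
apply: lip_approximable_unif => // eps eps0.
have c0 : 0 <= c by apply: le_trans (fc _ (fN point)).
pose K := Num.bound (2 * c / eps).
have Keps : 2 * c <= K%:R * eps.
  rewrite -ler_pdivrMr//; apply/ltW; apply: le_lt_trans (archi_boundP _).
    exact: lexx.
  by apply: divr_ge0; [exact: mulr_ge0|exact: ltW].
(* Adding [c] makes the function nonnegative with bound [2 * c], which the [K] levels reach;
   monotonicity of [f] makes each level set an up-set. *)
pose U k := [set mu | locfin mu /\ k.+1%:R * eps <= f mu + c].
pose Y w := - c + eps * \sum_(k < K) (\1_(N @^-1` U k) w : R).
exists Y.
  apply: lip_approximableD; first exact: lip_approximable_cst.
  apply: lip_approximableZ => //.
  elim: K {Keps Y} => [|K ih].
    rewrite (_ : (fun w => _) = fun=> 0); first exact: lip_approximable_cst.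
    by apply/funext => w; rewrite big_ord0.
  rewrite (_ : (fun w => _) = fun w =>
    \sum_(k < K) (\1_(N @^-1` U k) w : R) + \1_(N @^-1` U K) w); last first.
    by apply/funext => w; rewrite big_ord_recr.
  apply: lip_approximableD ih _; apply: lip_approximable_upset.
    have := ev_sigma_regular ds rN (mf _ (measurable_itv `[K.+1%:R * eps - c, +oo[)).
    congr inner_outer_regular; apply/seteqP.
    by split => mu /=; rewrite /U /= in_itv /= andbT lerBlDr.
  move=> mu nu [_ Umu] fmu fnu munu; split => //; apply: (le_trans Umu).
  by rewrite lerD2r; exact: upf.
move=> w; have /ler_normlP[fc1 fc2] := fc _ (fN w).
have u0 : 0 <= f (N w) + c by rewrite -lerBlDr sub0r lerNl.
have [+ _] := staircase K eps0 u0.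
have -> : \sum_(k < K) (k.+1%:R * eps <= f (N w) + c)%R%:R =
    \sum_(k < K) (\1_(N @^-1` U k) w : R).
  apply: eq_bigr => k _; rewrite indicE.
  rewrite (_ : (w \in _) = (k.+1%:R * eps <= f (N w) + c))//.
  apply/idP/idP => [|h]; first by rewrite inE => -[].
  by rewrite inE; split => //; exact: fN.
have uK : f (N w) + c <= K%:R * eps.
  by apply: le_trans Keps; rewrite mulr_natl mulr2n lerD2r.
move=> /(_ uK) /andP[h1 h2]; rewrite /Y ler_distl.
by apply/andP; split; lra.
Qed.

End approximation.

End cylinder_approximation.

(** * Finite-dimensional reduction *)

Section cov_sign.
Context (R : realType) d (Omega : measurableType d) (P : probability Omega R).
Variables X Y : Omega -> R.
Hypotheses (bX : bounded_rv X) (bY : bounded_rv Y).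

Lemma cov_le0P : (Exp P (fun w => (X w * Y w)%R) <= Exp P X * Exp P Y)%E <->
  cov P X Y <= 0.
Proof.
by rewrite (ExpE P bX) (ExpE P bY) (ExpE P (bounded_rvM bX bY)) lee_fin subr_le0.
Qed.

Lemma cov_ge0P : (Exp P X * Exp P Y <= Exp P (fun w => (X w * Y w)%R))%E <->
  0 <= cov P X Y.
Proof.
by rewrite (ExpE P bX) (ExpE P bY) (ExpE P (bounded_rvM bX bY)) lee_fin subr_ge0.
Qed.

End cov_sign.

(** The error on [X] is multiplied by the bound [c'] of [Y'], so [c'] may depend on [a] but must be
    known before [b]. The property [Q] will be a sign condition. *)
Lemma cov_approx (R : realType) d (Omega : measurableType d)
    (P : probability Omega R) (X Y : Omega -> R) (Q : R -> Prop) :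
    bounded_rv X -> bounded_rv Y ->
    (forall a, 0 < a -> exists c', forall b, 0 < b -> exists X' Y',
      [/\ bounded_rv X', bounded_rv Y', (forall w, `|Y' w| <= c') &
      [/\ \int[P]_w `|Y w - Y' w| <= a, \int[P]_w `|X w - X' w| <= b &
        Q (cov P X' Y')]]) ->
  forall eta, 0 < eta -> exists2 v, Q v & `|cov P X Y - v| <= eta.
Proof.
move=> bX bY h eta eta0; have [mX [c Xc]] := bX.
have c0 : 0 <= c by apply: le_trans (Xc point).
(* With this and the similar [b], each of the two terms in [cov_close] is at most [eta / 2]; the
   added 1 covers a zero bound. *)
pose a := eta / (4 * (c + 1)).
have a0 : 0 < a by rewrite divr_gt0// mulr_gt0// ltr_wpDl.
have [c' {}h] := h a a0.
pose b := eta / (4 * (`|c'| + 1)).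
have b0 : 0 < b by rewrite divr_gt0// mulr_gt0// ltr_wpDl.
have [X' [Y' [bX' bY' Yc' [hY hX hQ]]]] := h b b0.
exists (cov P X' Y') => //.
have c'0 : 0 <= c' by apply: le_trans (Yc' point).
apply: le_trans (cov_close P bX bY bX' bY' Xc Yc') _.
have ae : (c + 1) * a = eta / 4.
  by rewrite /a; field; apply/eqP; lra.
have be : (c' + 1) * b = eta / 4.
  by rewrite /b (ger0_norm c'0); field; apply/eqP; lra.
have := ler_wpM2l c0 hY; have := ler_wpM2l c'0 hX.
lra.
Qed.

(** * Restriction of measures and locality of test functions *)

Section restriction.
Context (R : realType) (S : pseudoPMetricType R).

Definition restr (mu : meas S) (A : set (Borel S)) (mA : measurable A) : meas S :=
  mrestr mu mA.

Lemma locfin_restr mu (A : set (Borel S)) (mA : measurable A) :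
  locfin mu -> locfin (restr mu mA).
Proof.
move=> fmu B mB bB; apply: le_lt_trans (fmu B mB bB).
by apply: le_measure; rewrite ?inE//; exact: measurableI.
Qed.

Lemma random_measure_restr d (Omega : measurableType d)
    (P : probability Omega R) (M : Omega -> meas S) (A : set (Borel S))
    (mA : measurable A) :
  random_measure P M -> random_measure P (fun w => restr (M w) mA).
Proof.
move=> [fM mM]; split => [w|B mB]; first exact: locfin_restr.
by apply: mM; exact: measurableI.
Qed.

(** The events that do not distinguish a measure from its restriction to [A] are closed under the
    sigma-algebra operations and contain the generators, which evaluate subsets of [A]. *)
Lemma ev_sigma_restr (A : set (Borel S)) (mA : measurable A) (E : set (meas S)) :
  ev_sigma (A : set S) E -> forall mu, locfin mu -> E mu <-> E (restr mu mA).
Proof.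
pose G := [set E : set (meas S) |
  forall mu, locfin mu -> E mu <-> E (restr mu mA)].
move: E; suff : ev_sigma (A : set S) `<=` G by [].
apply: smallest_sub => [|_ [B [U [mB BA mU ->]]] mu fmu]; last first.
  have rB : restr mu mA B = mu B by rewrite /restr /= /mrestr (setIidl BA).
  split => -[_ UB]; split => //; first exact: locfin_restr.
    exact: (eq_ind_r U UB rB).
  exact: (eq_ind _ U UB _ rB).
split => [//|E GE mu fmu|F GF mu fmu].
  split=> -[_ nE]; split; [exact: locfin_restr|by move/(GE _ fmu)|exact: fmu|].
  by move/(GE _ fmu).
by split=> -[i _ /(GF i _ fmu) Fi]; exists i.
Qed.

(** The fibre of [f] through [mu] is one of the events unchanged by restriction. *)
Lemma test_fun_restr (A : set (Borel S)) (mA : measurable A) (f : meas S -> R) mu :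
  meas_test_fun (A : set S) f -> locfin mu -> f (restr mu mA) = f mu.
Proof.
move=> [_ mf _] fmu; have := ev_sigma_restr mA (mf _ (measurable_set1 (f mu))) fmu.
by case=> /(_ (conj fmu erefl))[].
Qed.

End restriction.

Section finite_dimensional_tests.
Context (R : realType) (S : pseudoPMetricType R) (n : nat) (B : 'I_n -> set S).
Hypothesis mB : forall i, measurable (B i : set (Borel S)).
Hypothesis bB : forall i, metric_bounded (B i).
Variable J : {set 'I_n}.

(** [fine] sends an infinite mass to 0, so monotonicity rests on the [B i] being bounded and the
    measures locally finite. *)
Lemma vec_test_fun_meas (A : set S) (f : ({i : 'I_n | i \in J} -> R) -> R) :
    (forall i, i \in J -> B i `<=` A) -> vec_test_fun f ->
  meas_test_fun A (fun mu => f (subvec J (fun i => fine (mu (B i))))).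
Proof.
move=> BA [[c fc] mf upf]; split; first by exists c.
- move=> U /mf; set E := f @^-1` U.
  rewrite (_ : _ `&` _ = [set mu : meas S | locfin mu /\
      E (subvec J (fun i => fine (mu (B i))))])//.
  move: {mf U} E; pose G := [set E : set ({i | i \in J} -> R) | ev_sigma A
    [set mu : meas S | locfin mu /\ E (subvec J (fun i => fine (mu (B i))))]].
  suff : @vec_sigma R {i | i \in J} `<=` G by move=> h E; exact: h.
  have [s0 sC sU] := smallest_sigma_algebra [set mu : meas S | locfin mu] (ev_gen A).
  apply: smallest_sub => [|_ [k [V [mV ->]]]]; last first.
    apply: sub_gen_smallest; exists (B (val k)), (fine @^-1` V); split => //.
    + exact: BA (valP k).
    + by rewrite -[X in measurable X]setTI; exact: fine_measurable.
  split.
  + rewrite /G /= (_ : [set mu | _] = set0); first exact: s0.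
    by apply/seteqP; split => mu // [].
  + move=> E /sC; congr ev_sigma; apply/seteqP; split => mu /=.
      by move=> [fmu nE]; split => //; split => // Emu; apply: nE.
    by move=> [fmu [_ nE]]; split => // -[].
  + move=> F /sU; congr ev_sigma; apply/seteqP; split => mu /=.
      by move=> [i _ [fmu Fi]]; split => //; exists i.
    by move=> [fmu [i _ Fi]]; exists i.
- move=> mu nu fmu fnu munu; apply: upf => k.
  by rewrite /subvec fine_le ?ge0_fin_numE ?fmu ?fnu//; exact: munu.
Qed.

(** The coefficients [a] will say which blocks lie inside [X], so that the sum is the mass of [X].
    Being nonnegative they preserve monotonicity, and being at most 1 they give the Lipschitz
    constant [L * (size Xs)%:R]. *)
Lemma lip_cylinder_vec (I : set (set S)) h Xs L c (a : 'I_n -> set S -> bool) :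
    lip_cylinder I h Xs L c ->
  vec_test_fun (fun y : {i : 'I_n | i \in J} -> R =>
    h (fun X => \sum_k (a (val k) X)%:R * y k)).
Proof.
move=> [L0 _ hc hm hL]; split.
- by exists c => x; exact: hc.
- apply: (@lipschitz_vec_sigma _ _ (L * (size Xs)%:R)); first exact: mulr_ge0.
  move=> x y; apply: le_trans (hL _ _) _; rewrite -mulrA; apply: ler_wpM2l => //.
  apply: (@le_trans _ _ (\sum_(X <- Xs) \sum_k `|x k - y k|)).
    apply: ler_sum => X _; rewrite -sumrB; apply: le_trans (ler_norm_sum _ _ _) _.
    apply: ler_sum => k _; rewrite -mulrBr normrM.
    by case: (a _ _); rewrite ?normr1 ?normr0 ?mul1r// mul0r.
  by rewrite big_const_seq count_predT iter_addr_0 mulr_natl.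
- move=> x y xy; apply: hm => X _; apply: ler_sum => k _.
  by apply: ler_wpM2l => //; exact: xy.
Qed.

End finite_dimensional_tests.

(** * Disjoint blocks and replacement of Borel sets by ring sets *)

Section sufficiency.
Context (R : realType) (S : pseudoPMetricType R).
Context (I : set (set S)) (e : nat -> set S).
Hypothesis ds : dissecting_system I e.
Context d (Omega : measurableType d) (P : probability Omega R).
Variable M : Omega -> meas S.
Hypothesis rM : random_measure P M.

Let Isr := ds_semiring ds.
Let fM w : locfin (M w). Proof. by case: rM. Qed.

Lemma lip_cylinder_eq h Xs L c x y : lip_cylinder I h Xs L c ->
  (forall X, X \in Xs -> x X = y X) -> h x = h y.
Proof.
move=> [_ _ _ _ hL] xy; apply/eqP; rewrite -subr_eq0 -normr_le0.
apply: le_trans (hL _ _) _; rewrite big_seq big1 ?mulr0// => X /xy ->.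
by rewrite subrr normr0.
Qed.

(* The blocks are indexed by [size t + 1] to make the family nonempty: the
   last one is empty. *)
Let block (t : seq (set S)) (i : 'I_(size t).+1) := nth set0 t i.
Arguments block : clear implicits.

Let block_disjoint t : uniq t -> disjoint_seq t ->
  forall i j, i != j -> block t i `&` block t j = set0.
Proof.
move=> ut dt i j ij; apply/seteqP; split => // x [].
rewrite /block; have [it|it] := ltnP i (size t); last by rewrite (nth_default _ it).
have [jt|jt] := ltnP j (size t); last by rewrite (nth_default _ jt).
move=> xi xj; have /eqP := dt _ _ x (mem_nth set0 it) (mem_nth set0 jt) xi xj.
by rewrite nth_uniq// => /eqP/val_inj ijE; rewrite ijE eqxx in ij.
Qed.

Let block_mem t : (forall A, A \in t -> I A) -> forall i, I (block t i).
Proof.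
move=> It i; rewrite /block; have [it|it] := ltnP i (size t).
  exact/It/mem_nth.
by rewrite nth_default//; case: Isr.
Qed.

(** The blocks inside [Q] partition it. Empty blocks are exempted from [J] because they lie inside
    two disjoint sets at once but can be assigned to one side only. *)
Let block_sum t (Q : set S) (J : {set 'I_(size t).+1}) (mu : meas S) :
    uniq t -> (forall A, A \in t -> I A) -> disjoint_seq t ->
    separates t Q -> Q `<=` covered t -> in_ring I Q -> locfin mu ->
    (forall i, block t i `<=` Q -> i \in J \/ block t i = set0) ->
  \sum_(k : {i | i \in J}) `[< block t (val k) `<=` Q >]%:R *
    fine (mu (block t (val k))) = fine (mu Q).
Proof.
move=> ut It dt st ct rQ fmu QJ.
have fQ : (mu Q < +oo)%E by apply: (ring_lty ds) => // X; exact: (locfin_lty ds).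
rewrite (@fine_measure_blocks _ (Borel S) R mu t Q ut
  (fun A At => ds_measurable ds (It A At)) dt st ct (ds_ring_measurable ds rQ) fQ).
pose F i := `[< block t i `<=` Q >]%:R * fine (mu (block t i)).
rewrite -(big_sub (fun i => i \in J) F)/=.
transitivity (\sum_(i < (size t).+1) F i).
  rewrite big_mkcond /=; apply: eq_bigr => i _; case: ifPn => // iJ.
  rewrite /F; case: asboolP => iQ; last by rewrite mul0r.
  have [iJ'|->] := QJ i iQ; first by rewrite iJ' in iJ.
  by rewrite measure0 mulr0.
rewrite big_ord_recr /= [X in _ + X](_ : _ = 0) ?addr0; last first.
  by rewrite /F /block /= nth_default// measure0 mulr0.
rewrite (big_nth set0) big_mkord [RHS]big_mkcond /=; apply: eq_bigr => i _.
by rewrite /F /block /=; case: ifP => _; rewrite ?mul1r ?mul0r.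
Qed.

Lemma NA_vec_ring h Xs L c h' Xs' L' c' (A B : set (Borel S))
    (mA : measurable A) (mB : measurable B) :
    (forall (n : nat) (B : 'I_n -> set S), (0 < n)%N ->
      (forall i, I (B i)) -> (forall i j, i != j -> B i `&` B j = set0) ->
      NA_vec P (count_vec M B)) ->
    lip_cylinder I h Xs L c -> lip_cylinder I h' Xs' L' c' ->
    in_ring I A -> in_ring I B -> A `&` B = set0 ->
  cov P (fun w => h (coord (restr (M w) mA)))
        (fun w => h' (coord (restr (M w) mB))) <= 0.
Proof.
move=> NA lh lh' rA rB AB.
pose Rs := [seq X `&` A | X <- Xs] ++ [seq X `&` B | X <- Xs'].
have rRs Q : Q \in Rs -> in_ring I Q.
  rewrite mem_cat => /orP[] /mapP[X XXs ->]; apply: (in_ringI Isr) => //.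
    by apply: in_ring_sub; have [_ + _ _ _] := lh; apply.
  by apply: in_ring_sub; have [_ + _ _ _] := lh'; apply.
have [t [ut It dt st ct]] := ring_refine Isr rRs.
(* A nonempty block inside [B] is not inside [A], so [h] and [h'] read complementary groups of
   blocks. *)
pose J : {set 'I_(size t).+1} := [set i | `[< block t i `<=` A >]]%SET.
have E1 : (fun w => h (fun X => \sum_k `[< block t (val k) `<=` X `&` A >]%:R *
    subvec J (count_vec M (block t) w) k)) =
    (fun w => h (coord (restr (M w) mA))).
  apply/funext => w; apply: (lip_cylinder_eq lh) => X XXs.
  have XR : X `&` A \in Rs by rewrite mem_cat (map_f (fun X => X `&` A) XXs).
  rewrite -[RHS](block_sum (J := J) ut It dt (st _ XR) (ct _ XR) (rRs _ XR) (fM w))//.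
  by move=> i iXA; left; rewrite inE; apply/asboolP => x /iXA[].
have E2 : (fun w => h' (fun X => \sum_k `[< block t (val k) `<=` X `&` B >]%:R *
    subvec (~: J) (count_vec M (block t) w) k)) =
    (fun w => h' (coord (restr (M w) mB))).
  apply/funext => w; apply: (lip_cylinder_eq lh') => X XXs.
  have XR : X `&` B \in Rs by rewrite mem_cat (map_f (fun X => X `&` B) XXs) orbT.
  rewrite -[RHS](block_sum (J := ~: J) ut It dt (st _ XR) (ct _ XR) (rRs _ XR) (fM w))//.
  move=> i iXB; rewrite !inE; case: asboolP => iA; [right|by left].
  by apply/seteqP; split => // x ix; rewrite -AB; split; [exact: iA|have [] := iXB x ix].
have bh := bounded_rv_lip ds (random_measure_restr mA rM) lh.
have bh' := bounded_rv_lip ds (random_measure_restr mB rM) lh'.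
rewrite -E1 -E2 in bh bh' *; apply/(cov_le0P P bh bh').
exact: (NA _ (block t) (ltn0Sn _) (block_mem It) (block_disjoint ut dt) J _ _
    (lip_cylinder_vec J (fun i X => `[< block t i `<=` X `&` A >]) lh)
    (lip_cylinder_vec (~: J) (fun i X => `[< block t i `<=` X `&` B >]) lh')).
Qed.

Lemma PA_vec_coord h Xs L c h' Xs' L' c' :
    (forall (n : nat) (B : 'I_n -> set S), (0 < n)%N ->
      (forall i, I (B i)) -> (forall i j, i != j -> B i `&` B j = set0) ->
      PA_vec P (count_vec M B)) ->
    lip_cylinder I h Xs L c -> lip_cylinder I h' Xs' L' c' ->
  0 <= cov P (fun w => h (coord (M w))) (fun w => h' (coord (M w))).
Proof.
move=> PA lh lh'.
have rXs X : X \in Xs ++ Xs' -> in_ring I X.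
  rewrite mem_cat => XXs; apply: in_ring_sub.
  have [_ IX _ _ _] := lh; have [_ IX' _ _ _] := lh'.
  by case/orP: XXs => [/IX|/IX'].
have [t [ut It dt st ct]] := ring_refine Isr rXs.
pose J : {set 'I_(size t).+1} := [set: 'I_(size t).+1]%SET.
have hE g Ys K b : lip_cylinder I g Ys K b -> {subset Ys <= Xs ++ Xs'} ->
    (fun w => g (fun X => \sum_k `[< block t (val k) `<=` X >]%:R *
      subvec J (count_vec M (block t) w) k)) = (fun w => g (coord (M w))).
  move=> lg YX; apply/funext => w; apply: (lip_cylinder_eq lg) => X /YX XX.
  rewrite -[RHS](block_sum (J := J) ut It dt (st _ XX) (ct _ XX) (rXs _ XX) (fM w))//.
  by move=> i _; left; rewrite inE.
have sub1 : {subset Xs <= Xs ++ Xs'} by move=> X; rewrite mem_cat => ->.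
have sub2 : {subset Xs' <= Xs ++ Xs'}.
  by move=> X; rewrite mem_cat => ->; rewrite orbT.
have E1 := hE _ _ _ _ lh sub1; have E2 := hE _ _ _ _ lh' sub2.
have bh := bounded_rv_lip ds rM lh.
have bh' := bounded_rv_lip ds rM lh'.
rewrite -E1 -E2 in bh bh' *; apply/(cov_ge0P P bh bh').
exact: (PA _ (block t) (ltn0Sn _) (block_mem It) (block_disjoint ut dt) J _ _
    (lip_cylinder_vec J (fun i X => `[< block t i `<=` X >]) lh)
    (lip_cylinder_vec J (fun i X => `[< block t i `<=` X >]) lh')).
Qed.

(* [M] need not have finite mean, hence the truncation at [1]. *)
Let lam (D Z : set (Borel S)) : R :=
  \int[P]_w Num.min 1 (fine (M w (Z `&` D))).

Let bounded_min (Z : set (Borel S)) : measurable Z ->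
  bounded_rv (fun w => Num.min 1 (fine (M w Z))).
Proof.
move=> mZ; split.
  apply: measurable_minr => //.
  exact: (measurable_coord_random rM).
by exists 1 => w; rewrite ger0_norm ?ge_min ?lexx.
Qed.

Let ring_fin (D Z : set (Borel S)) w : in_ring I D -> measurable Z ->
  M w (Z `&` D) \is a fin_num.
Proof.
move=> rD mZ; rewrite ge0_fin_numE//.
have DM : (M w D < +oo)%E.
  by apply: (ring_lty ds) => // X; exact: (locfin_lty ds).
have mD := ds_ring_measurable ds rD.
by apply: le_lt_trans DM; apply: le_measure; rewrite ?inE//; exact: measurableI.
Qed.

(** This and the next two facts are what [in_ring_approx] asks of [lam D]. *)
Let lam_mono (D A B : set (Borel S)) : in_ring I D ->
  measurable A -> measurable B -> A `<=` B -> lam D A <= lam D B.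
Proof.
move=> rD mA mB AB; have mD := ds_ring_measurable ds rD.
apply: mean_le => [||w]; [apply: bounded_min; exact: measurableI..|].
have AD := @ring_fin D A w rD mA; have BD := @ring_fin D B w rD mB.
have h : fine (M w (A `&` D)) <= fine (M w (B `&` D)).
  apply: fine_le => //; apply: le_measure; rewrite ?inE; [exact: measurableI..|].
  exact: setSI.
by rewrite le_min !ge_min lexx h orbT.
Qed.

Let lamU (D A B : set (Borel S)) : in_ring I D ->
  measurable A -> measurable B -> lam D (A `|` B) <= lam D A + lam D B.
Proof.
move=> rD mA mB; have mD := ds_ring_measurable ds rD.
have mAB : measurable (A `|` B) by exact: measurableU.
have bA := bounded_min (measurableI _ _ mA mD).
have bB := bounded_min (measurableI _ _ mB mD).
rewrite -mean_D//; apply: mean_le => [||w].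
- by apply: bounded_min; exact: measurableI.
- exact: bounded_rvD.
have h : fine (M w ((A `|` B) `&` D)) <=
    fine (M w (A `&` D)) + fine (M w (B `&` D)).
  rewrite -fineD ?ring_fin//; apply: fine_le.
  - exact: ring_fin.
  - by rewrite fin_numD !ring_fin.
  - by rewrite setIUl; apply: measureU2; exact: measurableI.
have a0 : 0 <= fine (M w (A `&` D)) by rewrite fine_ge0.
have b0 : 0 <= fine (M w (B `&` D)) by rewrite fine_ge0.
rewrite ge_min; set a := fine (M w (A `&` D)) in h a0 *.
set b := fine (M w (B `&` D)) in h b0 *.
have [a1|a1] := leP 1 a.
  by apply/orP; left; rewrite lerDl le_min ler01.
have [b1|b1] := leP 1 b; first by rewrite lerDr a0.
by rewrite h orbT.
Qed.

Let lam0 (D : set (Borel S)) (F : nat -> set (Borel S)) : in_ring I D ->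
    (forall n, measurable (F n)) -> (forall n, F n.+1 `<=` F n) ->
    \bigcap_n F n = set0 ->
  forall eps, 0 < eps -> exists n, lam D (F n) < eps.
Proof.
move=> rD mF dF F0 eps eps0; have mD := ds_ring_measurable ds rD.
have bF n := bounded_min (measurableI _ _ (mF n) mD).
apply: mean_cvg0 => // [n|n w|w]; first by case: (bF n).
  by rewrite le_min ler01 fine_ge0// ge_min lexx.
have : (fun n => M w (F n `&` D)) @ \oo --> 0%:E.
  have -> : 0%:E = M w (\bigcap_n (F n `&` D)).
    rewrite (_ : \bigcap_n _ = set0) ?measure0//; apply/seteqP; split => // x h.
    by rewrite -F0 => n _; have [] := h n Logic.I.
  apply: nonincreasing_cvg_mu.
  + by rewrite -ge0_fin_numE// ring_fin.
  + by move=> n; exact: measurableI.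
  + by apply: bigcapT_measurable => n; exact: measurableI.
  + by apply/nonincreasing_seqP => n; apply/subsetPset; exact: setSI.
move=> /fine_cvg /cvgrPdist_lt h; apply/cvgrPdist_lt => e' e'0.
apply: filterS (h e' e'0) => n /=; rewrite !sub0r !normrN => h'.
have m0 : 0 <= fine (M w (F n `&` D)) by rewrite fine_ge0.
rewrite ger0_norm ?le_min ?ler01//; rewrite ger0_norm// in h'.
by rewrite gt_min h' orbT.
Qed.

(** Removing [A'] from the approximation of [B] makes the two disjoint. Since [A] misses [B], the
    points of [B] lost in this way lie in [A'] but not in [A], so the error of [A'] adds to that of
    [B']; hence [del / 2] for each. *)
Lemma disjoint_ring_approx (D A B : set (Borel S)) (del : R) : in_ring I D ->
    measurable A -> measurable B -> A `&` B = set0 -> 0 < del ->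
  exists A' B', [/\ in_ring I A', in_ring I B', A' `&` B' = set0,
    lam D ((A `\` A') `|` (A' `\` A)) <= del &
    lam D ((B `\` B') `|` (B' `\` B)) <= del].
Proof.
move=> rD mA mB AB del0; have d20 : 0 < del / 2 by rewrite divr_gt0.
have approx (C : set (Borel S)) : measurable C -> exists2 C', in_ring I C' &
    lam D ((C `\` C') `|` (C' `\` C)) < del / 2.
  move=> mC; apply: (@in_ring_approx _ (Borel S) R I Isr (ds_gen ds) e (lam D) C
    (ds_mem ds) (ds_total ds)) => //.
  - by move=> X Y mX mY; exact: lam_mono.
  - by move=> X Y mX mY; exact: lamU.
  - by move=> F mF dF F0; exact: lam0.
have [A' rA' hA] := approx A mA; have [B' rB' hB] := approx B mB.
have mA' := ds_ring_measurable ds rA'; have mB' := ds_ring_measurable ds rB'.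
exists A', (B' `\` A'); split => //.
- exact: in_ringD.
- by apply/seteqP; split => // x [? []].
- by apply/ltW/(lt_trans hA); rewrite ltr_pdivrMr// ltr_pMr// ltr1n.
have mU (X Y : set (Borel S)) : measurable X -> measurable Y ->
    measurable ((X `\` Y) `|` (Y `\` X)).
  by move=> mX mY; apply: measurableU; exact: measurableD.
apply: (@le_trans _ _ (lam D (((B `\` B') `|` (B' `\` B)) `|`
                            ((A `\` A') `|` (A' `\` A))))).
  apply: lam_mono => //.
  - by apply: mU => //; exact: measurableD.
  - by apply: measurableU; exact: mU.
  move=> x /= [[Bx nB']|[[B'x nA'x] nBx]]; last by left; right.
  have [B'x|nB'x] := pselect (B' x); last by left; left.
  right; right; split.
    by apply: contrapT => nA'x; apply: nB'.
  by move=> Ax; suff : set0 x by []; rewrite -AB.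
apply: le_trans (lamU rD (mU _ _ mB mB') (mU _ _ mA mA')) _.
by rewrite [del]splitr; apply/ltW/ltrD.
Qed.

(** Where the mass of the symmetric difference inside [D] is at least 1 the sup bound gives [2 * c];
    elsewhere the Lipschitz bound applies. Together they bound the error by a multiple of the
    truncated mass. *)
Lemma lip_restr_close h Xs L c (D A A' : set (Borel S)) (mA : measurable A)
    (mA' : measurable A') : lip_cylinder I h Xs L c -> in_ring I D ->
    (forall X, X \in Xs -> X `<=` D) ->
  \int[P]_w `|h (coord (restr (M w) mA)) - h (coord (restr (M w) mA'))| <=
    (2 * c + L * (size Xs)%:R) * lam D ((A `\` A') `|` (A' `\` A)).
Proof.
move=> lh rD XD; have mD := ds_ring_measurable ds rD.
set Z := _ `|` _; have mZ : measurable Z.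
  by apply: measurableU; exact: measurableD.
have bZ := bounded_min (measurableI _ _ mZ mD).
have bh := bounded_rv_lip ds (random_measure_restr mA rM) lh.
have bh' := bounded_rv_lip ds (random_measure_restr mA' rM) lh.
have [L0 IX hc _ hL] := lh.
rewrite -mean_Z//; apply: mean_le => [||w].
- by apply: bounded_rv_norm; exact: bounded_rvB.
- exact: bounded_rvZ.
set m := fine (M w (Z `&` D)).
have m0 : 0 <= m by rewrite fine_ge0.
have c0 : 0 <= c by apply: le_trans (hc (fun=> 0)).
have LX0 : 0 <= L * (size Xs)%:R by exact: mulr_ge0.
have hb : `|h (coord (restr (M w) mA)) - h (coord (restr (M w) mA'))| <= 2 * c.
  by apply: le_trans (ler_normB _ _) _; rewrite mulr_natl mulr2n; exact: lerD.
have close X : X \in Xs ->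
    `|coord (restr (M w) mA) X - coord (restr (M w) mA') X| <= m.
  move=> XXs; have mX : measurable (X : set (Borel S)).
    by apply: (ds_measurable ds); exact: IX.
  have fin (C : set (Borel S)) : measurable C -> M w (X `&` C) \is a fin_num.
    move=> mC; rewrite setIC ring_fin//; apply: in_ring_sub; exact: IX.
  have half (C C' : set (Borel S)) : measurable C -> measurable C' ->
      C `\` C' `<=` Z -> fine (M w (X `&` C)) <= m + fine (M w (X `&` C')).
    move=> mC mC' CZ; rewrite /m -fineD ?fin ?ring_fin//; apply: fine_le.
    - exact: fin.
    - by rewrite fin_numD fin// ring_fin.
    apply: le_trans (measureU2 _ _ _); last 2 first.
    - exact: measurableI.
    - exact: measurableI.
    apply: le_measure; rewrite ?inE; first exact: measurableI.
      by apply: measurableU; exact: measurableI.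
    move=> x [Xx Cx]; have [C'x|nC'x] := pselect (C' x); first by right.
    by left; split; [exact: CZ|exact: XD Xx].
  rewrite ler_distlC; apply/andP; split.
    rewrite lerBlDl; apply: (half A A' mA mA') => x ?; by left.
  rewrite addrC; apply: (half A' A mA' mA) => x ?; by right.
have hm : `|h (coord (restr (M w) mA)) - h (coord (restr (M w) mA'))| <=
    L * (size Xs)%:R * m.
  apply: le_trans (hL _ _) _; rewrite -mulrA; apply: ler_wpM2l => //.
  apply: (@le_trans _ _ (\sum_(X <- Xs) m)).
    by rewrite big_seq [leRHS]big_seq; apply: ler_sum => X /close.
  by rewrite big_const_seq count_predT iter_addr_0 mulr_natl.
have [m1|m1] := leP 1 m.
  by rewrite mulr1; apply: le_trans hb _; rewrite lerDl.
by apply: le_trans hm _; apply: ler_wpM2r => //; rewrite lerDr mulr_ge0.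
Qed.

End sufficiency.

(** * The equivalence *)

Lemma mean_triangle (R : realType) d (Omega : measurableType d)
    (P : probability Omega R) (X Y Z : Omega -> R) :
    bounded_rv X -> bounded_rv Y -> bounded_rv Z ->
  \int[P]_w `|X w - Z w| <= \int[P]_w `|X w - Y w| + \int[P]_w `|Y w - Z w|.
Proof.
move=> bX bY bZ.
have bXY := bounded_rv_norm (bounded_rvB bX bY).
have bYZ := bounded_rv_norm (bounded_rvB bY bZ).
rewrite -mean_D//; apply: mean_le => [||w].
- by apply: bounded_rv_norm; exact: bounded_rvB.
- exact: bounded_rvD.
- by rewrite -(subrKA (Y w)); exact: ler_normD.
Qed.

Section association_equivalence.
Context (R : realType) (S : pseudoPMetricType R).
Context (I : set (set S)) (e : nat -> set S).
Hypothesis ds : dissecting_system I e.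
Context d (Omega : measurableType d) (P : probability Omega R).
Variable M : Omega -> meas S.
Hypothesis rM : random_measure P M.

Let fM w : locfin (M w). Proof. by case: rM. Qed.

Lemma NA_meas_of_vec :
  (forall (n : nat) (B : 'I_n -> set S), (0 < n)%N ->
    (forall i, I (B i)) -> (forall i j, i != j -> B i `&` B j = set0) ->
    NA_vec P (count_vec M B)) -> NA_meas P M.
Proof.
move=> NA A B f g mA mB AB tf tg.
have bf := bounded_rv_test ds rM tf; have bg := bounded_rv_test ds rM tg.
apply/(cov_le0P P bf bg)/ler_addgt0Pr => eta eta0.
suff [v v0 hv] : exists2 v, v <= 0 &
    `|cov P (fun w => f (M w)) (fun w => g (M w)) - v| <= eta.
  by move: hv => /ler_normlP[_]; lra.
have rA := random_measure_restr mA rM; have rB := random_measure_restr mB rM.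
apply: (cov_approx (P := P) (Q := fun v => v <= 0) bf bg) => // a a0.
have a20 : 0 < a / 2 by rewrite divr_gt0.
have [_ /(_ _ a20)[h' [Xs' [L' [c' [lh' hg]]]]]] := lip_approximable_test ds rB tg.
exists c' => b b0; have b20 : 0 < b / 2 by rewrite divr_gt0.
have [_ /(_ _ b20)[h [Xs [L [c [lh hf]]]]]] := lip_approximable_test ds rA tf.
(* [D] contains every set whose mass [h] or [h'] reads, so changes of the Borel sets outside [D] are
   invisible. *)
pose D : set (Borel S) := covered (Xs ++ Xs').
have [L0 IX hc _ _] := lh; have [L'0 IX' hc' _ _] := lh'.
have rD : in_ring I D.
  by exists (Xs ++ Xs') => // X; rewrite mem_cat => /orP[/IX|/IX'].
have XD X : X \in Xs -> X `<=` D.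
  by move=> XXs x Xx; exists X => //; rewrite mem_cat XXs.
have XD' X : X \in Xs' -> X `<=` D.
  by move=> XXs x Xx; exists X => //; rewrite mem_cat XXs orbT.
pose C := 2 * c + L * (size Xs)%:R; pose C' := 2 * c' + L' * (size Xs')%:R.
have c0 : 0 <= c by apply: le_trans (hc (fun=> 0)).
have c'0 : 0 <= c' by apply: le_trans (hc' (fun=> 0)).
have C0 : 0 <= C by rewrite addr_ge0 ?mulr_ge0.
have C'0 : 0 <= C' by rewrite addr_ge0 ?mulr_ge0.
(* Chosen last, because it depends on the bounds and Lipschitz constants of both approximants; half
   of each tolerance was kept for this replacement. *)
pose del := Num.min (b / 2 / (C + 1)) (a / 2 / (C' + 1)).
have del0 : 0 < del by rewrite lt_min !divr_gt0// ltr_wpDl.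
have Cdel : C * del <= b / 2.
  have h1 : del * (C + 1) <= b / 2.
    by rewrite -ler_pdivlMr ?ltr_wpDl// ge_min lexx.
  by move: h1; rewrite mulrDr mulr1 mulrC; lra.
have C'del : C' * del <= a / 2.
  have h1 : del * (C' + 1) <= a / 2.
    by rewrite -ler_pdivlMr ?ltr_wpDl// ge_min lexx orbT.
  by move: h1; rewrite mulrDr mulr1 mulrC; lra.
have [A' [B' [rA' rB' AB' hA hB]]] := disjoint_ring_approx ds rM rD mA mB AB del0.
have mA' := ds_ring_measurable ds rA'; have mB' := ds_ring_measurable ds rB'.
exists (fun w => h (coord (restr (M w) mA'))),
  (fun w => h' (coord (restr (M w) mB'))).
have bh := bounded_rv_lip ds rA lh; have bh' := bounded_rv_lip ds rB lh'.
have bhA := bounded_rv_lip ds (random_measure_restr mA' rM) lh.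
have bhB := bounded_rv_lip ds (random_measure_restr mB' rM) lh'.
have fE w : f (restr (M w) mA) = f (M w) by exact: test_fun_restr.
have gE w : g (restr (M w) mB) = g (M w) by exact: test_fun_restr.
split => //; split.
- apply: le_trans (mean_triangle P bg bh' bhB) _; rewrite [a]splitr; apply: lerD.
    by under eq_Rintegral do rewrite -gE.
  apply: le_trans (lip_restr_close ds rM mB mB' lh' rD XD') _.
  by apply: le_trans C'del; exact: ler_wpM2l.
- apply: le_trans (mean_triangle P bf bh bhA) _; rewrite [b]splitr; apply: lerD.
    by under eq_Rintegral do rewrite -fE.
  apply: le_trans (lip_restr_close ds rM mA mA' lh rD XD) _.
  by apply: le_trans Cdel; exact: ler_wpM2l.
- exact: (NA_vec_ring ds rM mA' mB' NA lh lh').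
Qed.

Lemma PA_meas_of_vec :
  (forall (n : nat) (B : 'I_n -> set S), (0 < n)%N ->
    (forall i, I (B i)) -> (forall i j, i != j -> B i `&` B j = set0) ->
    PA_vec P (count_vec M B)) -> PA_meas P M.
Proof.
move=> PA f g tf tg.
have bf := bounded_rv_test ds rM tf; have bg := bounded_rv_test ds rM tg.
apply/(cov_ge0P P bf bg)/ler_addgt0Pr => eta eta0.
suff [v v0 hv] : exists2 v, 0 <= v &
    `|cov P (fun w => f (M w)) (fun w => g (M w)) - v| <= eta.
  by move: hv => /ler_normlP[+ _]; lra.
apply: (cov_approx (P := P) (Q := fun v => 0 <= v) bf bg) => // a a0.
have [_ /(_ _ a0)[h' [Xs' [L' [c' [lh' hg]]]]]] := lip_approximable_test ds rM tg.
exists c' => b b0.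
have [_ /(_ _ b0)[h [Xs [L [c [lh hf]]]]]] := lip_approximable_test ds rM tf.
exists (fun w => h (coord (M w))), (fun w => h' (coord (M w))); split.
- exact: (bounded_rv_lip ds rM lh).
- exact: (bounded_rv_lip ds rM lh').
- by move=> w; have [_ _ + _ _] := lh'; apply.
- by split => //; exact: (PA_vec_coord ds rM PA lh lh').
Qed.

Lemma NA_vec_of_meas (n : nat) (B : 'I_n -> set S) :
    (forall i, I (B i)) -> (forall i j, i != j -> B i `&` B j = set0) ->
  NA_meas P M -> NA_vec P (count_vec M B).
Proof.
move=> IB dB NA J f g tf tg.
have mB i : measurable (B i : set (Borel S)) by exact: (ds_measurable ds).
have bB i : metric_bounded (B i) by exact: (ds_bounded ds).
pose A (K : {set 'I_n}) : set (Borel S) := \bigcup_(i in [set i | i \in K]) B i.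
have mA K : measurable (A K) by apply: fin_bigcup_measurable.
have BA (K : {set 'I_n}) i : i \in K -> B i `<=` A K.
  by move=> iK x Bx; exists i.
apply: (NA (A J) (A (~: J)) _ _ (mA _) (mA _) _
  (vec_test_fun_meas mB bB (BA J) tf) (vec_test_fun_meas mB bB (BA _) tg)).
apply/seteqP; split => // x [[i /= iJ Bi] [j /= jJ Bj]].
have ij : i != j.
  by apply: contraTneq iJ => ->; move: jJ; rewrite inE.
by have : (B i `&` B j) x by []; rewrite dB.
Qed.

Lemma PA_vec_of_meas (n : nat) (B : 'I_n -> set S) :
  (forall i, I (B i)) -> PA_meas P M -> PA_vec P (count_vec M B).
Proof.
move=> IB PA J f g tf tg.
have mB i : measurable (B i : set (Borel S)) by exact: (ds_measurable ds).
have bB i : metric_bounded (B i) by exact: (ds_bounded ds).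
by apply: (PA _ _ (vec_test_fun_meas mB bB _ tf) (vec_test_fun_meas mB bB _ tg)).
Qed.

End association_equivalence.

Lemma dissecting_system_exists (R : realType) (S : pseudoPMetricType R)
    (I : set (set S)) :
    countable I ->
    (forall X, I X -> measurable (X : set (Borel S)) /\ metric_bounded X) ->
    semiring_of_sets I ->
    <<s I >> = (measurable : set (set (Borel S))) ->
    dissecting I ->
  exists e, dissecting_system I e.
Proof.
move=> cI mbI Isr Igen [dopen dcov].
have [I0 _ _] := Isr; have /countable_injP[c cinj] := cI.
(* [e] inverts the injection [c]; indices outside its range receive the empty set, a member of
   [I]. *)
have /choice[e he] : forall n, exists X, I X /\ forall Y, I Y -> c Y = n -> Y = X.
  move=> n; have [[X [IX cX]]|nX] := pselect (exists X, I X /\ c X = n).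
    exists X; split => // Y IY cY; apply: cinj; rewrite ?inE//.
    by rewrite cX.
  by exists set0; split => // Y IY cY; case: nX; exists Y.
have enum X : I X -> exists n, X = e n.
  by move=> IX; exists (c X); exact: (he (c X)).2.
exists e; split => //.
- by move=> X /mbI[].
- by move=> X /mbI[].
- move=> B mB bB; have [C [/finite_seqP[s ->] CI BC]] := dcov B mB bB.
  exists (covered s); first by exists s.
  by move=> x /BC[X Xs Xx]; exists X.
- by move=> n; exact: (he n).1.
- have [C [_ CI SC]] := dopen setT openT.
  apply/seteqP; split => // x xT; move: (xT); rewrite SC => -[X CX Xx].
  by have [n Xn] := enum X (CI X CX); exists n => //; rewrite -Xn.
Qed.

Theorem theorem4p4 (R : realType) (S : completePseudoMetricType R)
    (d : measure_display) (Omega : measurableType d) (P : probability Omega R)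
    (M : Omega -> meas S) (I : set (set S)) :
  hausdorff_space S -> separable_space S ->
  random_measure P M ->
  countable I ->
  (forall X, I X -> measurable (X : set (Borel S)) /\ metric_bounded X) ->
  semiring_of_sets I ->
  <<s I >> = (measurable : set (set (Borel S))) ->
  dissecting I ->
  (NA_meas P M <->
     forall (n : nat) (B : 'I_n -> set S), (0 < n)%N ->
       (forall i, I (B i)) -> (forall i j, i != j -> B i `&` B j = set0) ->
       NA_vec P (count_vec M B)) /\
  (PA_meas P M <->
     forall (n : nat) (B : 'I_n -> set S), (0 < n)%N ->
       (forall i, I (B i)) -> (forall i j, i != j -> B i `&` B j = set0) ->
       PA_vec P (count_vec M B)).

Proof.
move=> _ _ rM cI mbI Isr Igen dI.
have [e ds] := dissecting_system_exists cI mbI Isr Igen dI.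
split; split => [h n B n0 IB dB|h].
- exact: (NA_vec_of_meas ds).
- exact: (NA_meas_of_vec ds).
- exact: (PA_vec_of_meas ds).
- exact: (PA_meas_of_vec ds).
Qed.
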